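(* Let $X$ be the space of all sequences of the form $c=\sum_{k=1}^N a_k\star b_k$ (finite sums) with $a_k,b_k$ finitely supported sequences, normed by $\|c\|_X=\inf\sum_{k=1}^N\|a_k\|_{\ell^2(\mathbb{N})}\|b_k\|_{\ell^2(\mathbb{N})}$, the infimum over all such finite representations of $c$, and let $\mathcal{X}$ be the Banach space completion of $X$. For $c\in X$ define $Lc\in\mathcal{M}_0^*$ by $Lc(m)=(\alpha,c)$ for $m=M(\alpha)\in\mathcal{M}_0$. Then $L$ extends to an isometric isomorphism $L\colon\mathcal{X}\to\mathcal{M}_0^*$, and $L^*U^{-1}=J$, where $U\colon\mathcal{M}_0^{**}\to\mathcal{M}$ is the unique isometric isomorphism with $U\iota_{\mathcal{M}_0}m=m$ for all $m\in\mathcal{M}_0$, and $J\colon\mathcal{M}\to\mathcal{X}^*$ is the isometric isomorphism determined by $Jm(c)=(\alpha,c)$ for $m=M(\alpha)\in\mathcal{M}$, $c\in X$.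
   Context: For a sequence $\alpha\colon\mathbb{N}\to\mathbb{C}$, the multiplicative Hankel operator $M(\alpha)$ is defined by $\langle M(\alpha)a,b\rangle_{\ell^2(\mathbb{N})}=\sum_{n,m}a(n)\overline{b(m)}\alpha(nm)$ for finitely supported $a,b$; $\mathcal{M}$ (resp. $\mathcal{M}_0$) is the space of those $M(\alpha)$ which extend to bounded (resp. compact) operators on $\ell^2(\mathbb{N})$, with the operator norm. The Dirichlet convolution is $(a\star b)(n)=\sum_{k\mid n}a(k)\overline{b(n/k)}$, and $(a,b)=\sum_{n}a(n)b(n)$ is the bilinear pairing. $\iota_{\mathcal{M}_0}\colon\mathcal{M}_0\to\mathcal{M}_0^{**}$ is the canonical embedding. (It is part of the setting that such $U$ exists uniquely and that $J$ extends to an isometric isomorphism of $\mathcal{M}$ onto $\mathcal{X}^*$.) *)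

(* Defs.v *)
From HB Require Import structures.
From mathcomp Require Import all_boot all_order all_algebra.
From mathcomp Require Import all_classical all_reals.
From mathcomp Require Import topology normedtype.
From mathcomp Require Import complex.

Set Implicit Arguments.
Unset Strict Implicit.
Unset Printing Implicit Defensive.

Import Order.TTheory GRing.Theory Num.Theory.
Local Open Scope ring_scope.

Section Defs.
Variable R : realType.
Local Notation normc := (@ComplexField.Normc.normc R).
Local Notation C := R[i].

(* Sequences N -> C, where N = {1,2,...}; we use functions nat -> C and
   systematically ignore / require 0 at the index 0. *)
Definition sq := nat -> C.

Definition sq_lin (k : C) (a b : sq) : sq := fun n => k * a n + b n.

Definition supp_in (a : sq) (N : nat) : Prop :=
  a 0%N = 0 /\ forall n, (N <= n)%N -> a n = 0.

Definition fsupp (a : sq) : Prop := exists N, supp_in a N.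

Definition l2partial (a : sq) (N : nat) : R :=
  \sum_(1 <= n < N) normc (a n) ^+ 2.

Definition l2norm (a : sq) : R :=
  Num.sqrt (sup [set l2partial a N | N in [set: nat]]).

Definition l2le (x : sq) (r : R) : Prop :=
  0 <= r /\ forall N, l2partial x N <= r ^+ 2.

(* <M(alpha) a, b> for a, b supported in {1,...,N-1} *)
Definition Mform (alpha a b : sq) (N : nat) : C :=
  \sum_(1 <= n < N) \sum_(1 <= m < N) a n * conjc (b m) * alpha (n * m)%N.

Definition Mapply (alpha a : sq) (N : nat) : sq :=
  fun m => if m == 0%N then 0 else \sum_(1 <= n < N) a n * alpha (n * m)%N.

Definition Mbound (alpha : sq) (K : R) : Prop :=
  0 <= K /\ forall (a b : sq) (N : nat), supp_in a N -> supp_in b N ->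
    normc (Mform alpha a b N) <= K * l2norm a * l2norm b.

(* M(alpha) extends to a bounded operator on l^2(N) : alpha in the space  M *)
Definition inM (alpha : sq) : Prop := alpha 0%N = 0 /\ exists K, Mbound alpha K.

Definition opnorm (alpha : sq) : R := inf [set K | Mbound alpha K].

(* M(alpha) is compact: the image of the (finitely supported part of the)
   closed unit ball is totally bounded in l^2 *)
Definition Mcompact (alpha : sq) : Prop :=
  forall eps : R, 0 < eps ->
    exists fs : seq sq, forall (a : sq) (N : nat), supp_in a N -> l2norm a <= 1 ->
      exists2 f, f \in fs & l2le (fun m => Mapply alpha a N m - f m) eps.

Definition inM0 (alpha : sq) : Prop := inM alpha /\ Mcompact alpha.

(* the dual M_0^* : functionals phi on sequences, linear and bounded on M_0 *)
Definition fnl := sq -> C.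

Definition dual_bound (phi : fnl) (K : R) : Prop :=
  0 <= K /\ forall alpha, inM0 alpha -> normc (phi alpha) <= K * opnorm alpha.

Definition in_dual (phi : fnl) : Prop :=
  (forall (k : C) alpha beta, inM0 alpha -> inM0 beta ->
     phi (sq_lin k alpha beta) = k * phi alpha + phi beta)
  /\ exists K, dual_bound phi K.

Definition dualnorm (phi : fnl) : R := inf [set K | dual_bound phi K].

Definition bfnl := fnl -> C.

Definition bidual_bound (Phi : bfnl) (K : R) : Prop :=
  0 <= K /\ forall phi, in_dual phi -> normc (Phi phi) <= K * dualnorm phi.

Definition in_bidual (Phi : bfnl) : Prop :=
  (forall (k : C) phi psi, in_dual phi -> in_dual psi ->
     Phi (fun alpha => k * phi alpha + psi alpha) = k * Phi phi + Phi psi)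
  /\ exists K, bidual_bound Phi K.

Definition bidualnorm (Phi : bfnl) : R := inf [set K | bidual_bound Phi K].

Definition iotaM (alpha : sq) : bfnl := fun phi => phi alpha.

Definition dconv (a b : sq) : sq :=
  fun n => \sum_(1 <= k < n.+1 | (k %| n)%N) a k * conjc (b (n %/ k)%N).

Definition conv_sum (s : seq (sq * sq)) : sq :=
  fun n => \sum_(p <- s) dconv p.1 p.2 n.

Definition is_rep (c : sq) (s : seq (sq * sq)) : Prop :=
  (forall p, p \in s -> fsupp p.1 /\ fsupp p.2) /\ c = conv_sum s.

Definition inX (c : sq) : Prop := exists s, is_rep c s.

Definition normX (c : sq) : R :=
  inf [set \sum_(p <- s) l2norm p.1 * l2norm p.2 | s in is_rep c].

Definition fbound (c : sq) : nat :=
  match pselect (fsupp c) with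
  | left h => projT1 (cid h)
  | right _ => 0%N
  end.

Definition pair (alpha c : sq) : C := \sum_(1 <= n < fbound c) alpha n * c n.

End Defs.

(* Main.v *)
(**
  Write [<M(al) a, b>] as a bilinear form in [a], [b] with matrix [al (n * m)].
  Let [s n] be the sum of the prime factors of [n] with multiplicity.  The Fejer weight
  [w_T n = (1 - s n / T)_+] is finitely supported, tends to [1] pointwise, and [w_T (n * m)]
  is an average of products of indicators of [n] and of [m], so multiplication by [w_T] is a
  contraction both of [M] (into finitely supported, hence compact, operators) and of [X].

  Isometry: Hahn-Banach on the finite-dimensional range of [w_T] gives, for [c] in [X], a
  finitely supported [al] with [||M(al)|| <= 1] and [(al, c)] close to [||c||_X].

  Surjectivity: if [phi] is bounded on [M_0], then [phi (w_T al) -> phi al] uniformly on the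
  unit ball.  Otherwise there are [k] humps [al_i - w_{T_i} al_i] on which [phi] is bounded
  below; spaced out they occupy disjoint hooks of the matrix, so their sum has norm
  [O(sqrt k)] while [phi] of it grows like [k].  The functionals [phi o w_T] are given by
  elements of [X], which are then Cauchy.

  [L^* U^-1 = J]: put [al n = Phi (be |-> be n)].  As [U] is isometric and fixes [M_0],
  [||U Phi + g|| = ||al + g||] for [g] in [M_0].  Choose [g = x - z] with
  [x = ||al|| zeta delta_n] and [z] an average of [k] spaced truncations [w_{T_i} al]: the
  hooks again average to [O(1 / sqrt k)], so [||al + x - z||] is at most about [||al||], and
  reading off the entry [n] forces [(U Phi) n = al n].
*)
Require Import Defs.
From HB Require Import structures.
From mathcomp Require Import all_boot all_order all_algebra.
From mathcomp Require Import all_classical all_reals.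
From mathcomp Require Import topology normedtype.
From mathcomp Require Import complex.
From mathcomp Require Import ring lra zify.
Import Order.TTheory GRing.Theory Num.Theory.
Local Open Scope classical_set_scope.
Local Open Scope ring_scope.
Set Implicit Arguments.
Unset Strict Implicit.
Unset Printing Implicit Defensive.

(** * Complex modulus and finite Cauchy-Schwarz *)

Section ComplexModulus.
Variable R : realType.
Local Notation normc := (@ComplexField.Normc.normc R).
Local Notation C := R[i].
Implicit Types x y z : C.

Lemma normcE_sqrt z : normc z = Num.sqrt (complex.Re z ^+ 2 + complex.Im z ^+ 2).
Proof. by case: z. Qed.

Lemma normc_norm z : `|z| = ((normc z)%:C)%C.
Proof. by rewrite normc_def normcE_sqrt. Qed.

Lemma normc_ge0 z : 0 <= normc z.
Proof. by rewrite normcE_sqrt sqrtr_ge0. Qed.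

Lemma sqr_normcE z : normc z ^+ 2 = complex.Re z ^+ 2 + complex.Im z ^+ 2.
Proof. by rewrite normcE_sqrt sqr_sqrtr // addr_ge0 ?sqr_ge0. Qed.

Lemma normc0E : normc 0 = 0.
Proof. by rewrite ComplexField.Normc.normc0. Qed.

Lemma normc1E : normc 1 = 1.
Proof. by rewrite ComplexField.Normc.normc1. Qed.

Lemma normcM x y : normc (x * y) = normc x * normc y.
Proof. exact: ComplexField.Normc.normcM. Qed.

Lemma ler_normcD x y : normc (x + y) <= normc x + normc y.
Proof.
by rewrite -lecR rmorphD /= -!normc_norm ler_normD.
Qed.

Lemma normcN x : normc (- x) = normc x.
Proof. by apply: complexI; rewrite -!normc_norm normrN. Qed.

Lemma normc_distC x y : normc (x - y) = normc (y - x).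
Proof. by rewrite -normcN opprB. Qed.

Lemma ler_normcB x y : normc (x - y) <= normc x + normc y.
Proof. by rewrite (le_trans (ler_normcD _ _))// normcN. Qed.

Lemma ler_normc_distD y x z : normc (x - z) <= normc (x - y) + normc (y - z).
Proof. by rewrite (le_trans _ (ler_normcD _ _))// addrA subrK. Qed.

Lemma normcJ x : normc (conjc x) = normc x.
Proof. by case: x => a b; rewrite !normcE_sqrt /= sqrrN. Qed.

Lemma normc_real (r : R) : normc (r%:C)%C = `|r|.
Proof. by rewrite normcE_sqrt /= expr0n /= addr0 sqrtr_sqr. Qed.

Lemma normc_eq0 x : normc x = 0 -> x = 0.
Proof. exact: ComplexField.Normc.eq0_normc. Qed.

Lemma normc_gt0 x : x != 0 -> 0 < normc x.
Proof.
by move=> x0; rewrite lt_def normc_ge0 andbT; apply: contra x0 => /eqP/normc_eq0/eqP.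
Qed.

Lemma normc_sum (I : Type) (r : seq I) (P : pred I) (F : I -> C) :
  normc (\sum_(i <- r | P i) F i) <= \sum_(i <- r | P i) normc (F i).
Proof.
elim/big_rec2: _ => [|i y x _ le]; first by rewrite normc0E.
by rewrite (le_trans (ler_normcD _ _)) // lerD2l.
Qed.

Lemma Re_le_normc z : `|complex.Re z| <= normc z.
Proof.
by rewrite normcE_sqrt -sqrtr_sqr ler_sqrt ?lerDl ?sqr_ge0 // addr_ge0 ?sqr_ge0.
Qed.

Lemma Im_le_normc z : `|complex.Im z| <= normc z.
Proof.
by rewrite normcE_sqrt -sqrtr_sqr ler_sqrt ?lerDr ?sqr_ge0 // addr_ge0 ?sqr_ge0.
Qed.

Lemma normc_le_ReIm z : normc z <= `|complex.Re z| + `|complex.Im z|.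
Proof.
rewrite -(ler_pXn2r (n := 2)) ?nnegrE ?normc_ge0 ?addr_ge0 //.
rewrite sqr_normcE sqrrD !real_normK ?num_real //.
by rewrite lerD2r lerDl mulrn_wge0 // mulr_ge0.
Qed.

Lemma mulcJ_normc z : z * conjc z = ((normc z ^+ 2)%:C)%C.
Proof. by rewrite rmorphXn /= -normc_norm sqr_normc. Qed.

(** A unimodular factor turns a modulus into a real part, so that estimates for real functionals
    apply to complex ones. *)
Lemma rotation_exists z : exists2 u, normc u = 1 & u * z = ((normc z)%:C)%C.
Proof.
have [->|z0] := eqVneq z 0.
  by exists 1; rewrite ?normc1E // mul1r normc0E.
have n0 := normc_gt0 z0.
exists (((normc z)^-1)%:C%C * conjc z).
  by rewrite normcM normcJ normc_real ger0_norm ?invr_ge0 ?ltW // mulVf // gt_eqF.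
rewrite -mulrA [conjc z * z]mulrC mulcJ_normc -rmorphM /= expr2 mulrA mulVf ?gt_eqF //.
by rewrite mul1r.
Qed.

(** The form in which density arguments end: an error bound linear in [e]. Dividing by [K + 1]
    covers [K = 0]. *)
Lemma normc_le_eps (K : R) z : 0 <= K -> (forall e, 0 < e -> normc z <= K * e) -> z = 0.
Proof.
move=> K0 h; apply: normc_eq0; apply/eqP; rewrite eq_le normc_ge0 andbT.
apply/ler_addgt0Pl => e e0; rewrite addr0.
have K1 : 0 < K + 1 by rewrite ltr_wpDl.
apply: (le_trans (h (e / (K + 1)) _)); first by rewrite divr_gt0.
by rewrite mulrCA ger_pMr // ler_pdivrMr // mul1r lerDl.
Qed.

End ComplexModulus.

Section RealSums.
Variable R : realType.

Lemma CauchySchwarz2 (a b c d : R) :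
  a * b + c * d <= Num.sqrt (a ^+ 2 + c ^+ 2) * Num.sqrt (b ^+ 2 + d ^+ 2).
Proof.
rewrite -sqrtrM ?addr_ge0 ?sqr_ge0 // (le_trans (ler_norm _)) // -sqrtr_sqr.
rewrite ler_sqrt ?mulr_ge0 ?addr_ge0 ?sqr_ge0 //.
rewrite -subr_ge0 [X in 0 <= X](_ : _ = (a * d - b * c) ^+ 2) ?sqr_ge0 //; ring.
Qed.

Lemma CauchySchwarz_sum (I : Type) (r : seq I) (P : pred I) (x y : I -> R) :
  \sum_(i <- r | P i) x i * y i <=
  Num.sqrt (\sum_(i <- r | P i) x i ^+ 2) * Num.sqrt (\sum_(i <- r | P i) y i ^+ 2).
Proof.
elim: r => [|i r IH]; first by rewrite !big_nil sqrtr0 mul0r.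
rewrite !big_cons; case: (P i) => //.
set A := \sum_(j <- r | _) x j ^+ 2; set B := \sum_(j <- r | _) y j ^+ 2.
have A0 : 0 <= A by apply: sumr_ge0 => j _; exact: sqr_ge0.
have B0 : 0 <= B by apply: sumr_ge0 => j _; exact: sqr_ge0.
apply: (le_trans (lerD (lexx _) IH)).
by apply: (le_trans (CauchySchwarz2 _ _ _ _)); rewrite !sqr_sqrtr.
Qed.

End RealSums.

(** * Bilinear forms of infinite matrices and the operator norm *)

Section Forms.
Variable R : realType.
Local Notation normc := (@ComplexField.Normc.normc R).
Local Notation C := R[i].
Local Notation sq := (sq R).
Implicit Types (a b c al be : sq) (N : nat).

(** A finite sum, hence meaningful without summability; it agrees with [l2norm] for sequences
    supported below [N]. *)
Definition nl (a : sq) (N : nat) : R := Num.sqrt (l2partial a N).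

Lemma l2partial_ge0 a N : 0 <= l2partial a N.
Proof. by apply: sumr_ge0 => n _; exact: sqr_ge0. Qed.

Lemma nl_ge0 a N : 0 <= nl a N.
Proof. exact: sqrtr_ge0. Qed.

Lemma sqr_nl a N : nl a N ^+ 2 = l2partial a N.
Proof. by rewrite sqr_sqrtr // l2partial_ge0. Qed.

Lemma l2partial_le a N M : (N <= M)%N -> l2partial a N <= l2partial a M.
Proof.
move=> NM; rewrite /l2partial.
have [N1|N1] := leqP 1 N; last by rewrite big_geq ?(ltnW N1)// sumr_ge0 // => n _; exact: sqr_ge0.
by rewrite (big_cat_nat (n:=N) (p:=M)) //= lerDl sumr_ge0 // => n _; exact: sqr_ge0.
Qed.

Lemma l2partial_supp a N M : supp_in a N -> (N <= M)%N -> l2partial a M = l2partial a N.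
Proof.
move=> [_ aN] NM; rewrite /l2partial.
have [N1|N1] := leqP 1 N.
  rewrite (big_cat_nat (n:=N) (p:=M)) //= [X in _ + X]big_nat_cond [X in _ + X]big1 ?addr0 //.
  by move=> n /andP[/andP[h _] _]; rewrite aN // normc0E expr0n.
rewrite [RHS]big_geq ?(ltnW N1)// big_nat_cond big1 // => n _.
by rewrite aN ?normc0E ?expr0n //; move: N1; rewrite ltnS leqn0 => /eqP ->.
Qed.

Lemma l2norm_supp a N : supp_in a N -> l2norm a = nl a N.
Proof.
move=> sa; rewrite /l2norm /nl; congr Num.sqrt.
apply/eqP; rewrite eq_le; apply/andP; split.
  apply: ge_sup; first by exists (l2partial a 0), 0%N.
  move=> _ [M _ <-]; have [h|h] := leqP N M; first by rewrite (l2partial_supp sa h).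
  by apply: l2partial_le; exact: ltnW.
apply: ub_le_sup; last by exists N.
exists (l2partial a N) => _ [M _ <-]; have [h|h] := leqP N M; first by rewrite (l2partial_supp sa h).
by apply: l2partial_le; exact: ltnW.
Qed.

Lemma l2norm_ge0 a : 0 <= l2norm a.
Proof. exact: sqrtr_ge0. Qed.

Definition cut (P : pred nat) (a : sq) : sq := fun n => if P n then a n else 0.

Definition trunc (N : nat) (a : sq) : sq := cut (fun n => (0 < n < N)%N) a.

Lemma trunc_supp N a : supp_in (trunc N a) N.
Proof.
by split=> [|n h]; rewrite /trunc /cut //= [(n < N)%N]ltnNge h andbF.
Qed.

Lemma eq_l2partial a b N : (forall n, (0 < n < N)%N -> normc (a n) = normc (b n)) ->
  l2partial a N = l2partial b N.
Proof. by move=> h; apply: eq_big_nat => n hn; rewrite h. Qed.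

Lemma eq_nl a b N : (forall n, (0 < n < N)%N -> normc (a n) = normc (b n)) ->
  nl a N = nl b N.
Proof. by move=> h; rewrite /nl (eq_l2partial h). Qed.

Lemma le_nl a b N : (forall n, (0 < n < N)%N -> normc (a n) <= normc (b n)) ->
  nl a N <= nl b N.
Proof.
move=> h; rewrite /nl ler_sqrt ?l2partial_ge0 // /l2partial big_nat_cond [leRHS]big_nat_cond.
apply: ler_sum => n /andP[hn _]; rewrite ler_pXn2r ?nnegrE ?normc_ge0 //; exact: h.
Qed.

Lemma nl_trunc N a : nl (trunc N a) N = nl a N.
Proof. by apply: eq_nl => n h; rewrite /trunc /cut h. Qed.

Lemma nlJ a N : nl (fun n => conjc (a n)) N = nl a N.
Proof. by apply: eq_nl => n _; rewrite normcJ. Qed.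

Lemma nl_scale (k : C) a N : nl (fun n => k * a n) N = normc k * nl a N.
Proof.
rewrite /nl -[normc k]ger0_norm ?normc_ge0 // -sqrtr_sqr -sqrtrM ?sqr_ge0 //.
by rewrite /l2partial mulr_sumr; congr Num.sqrt; apply: eq_bigr => n _; rewrite normcM exprMn.
Qed.

Lemma nl_cut P a N : nl (cut P a) N <= nl a N.
Proof.
by apply: le_nl => n _; rewrite /cut; case: ifP => // _; rewrite normc0E normc_ge0.
Qed.

Lemma sqr_nl_cut P a N :
  nl a N ^+ 2 = nl (cut P a) N ^+ 2 + nl (cut (predC P) a) N ^+ 2.
Proof.
rewrite !sqr_nl /l2partial -big_split /=; apply: eq_bigr => n _.
by rewrite /cut /=; case: (P n); rewrite normc0E expr0n /= ?addr0 ?add0r.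
Qed.

Lemma normc_le_nl a N n : (0 < n < N)%N -> normc (a n) <= nl a N.
Proof.
move=> h; rewrite /nl -[normc (a n)]ger0_norm ?normc_ge0 // -sqrtr_sqr ler_sqrt ?l2partial_ge0 //.
rewrite /l2partial (bigD1_seq n) /=; first last.
- exact: iota_uniq.
- by rewrite mem_index_iota.
by rewrite lerDl sumr_ge0 // => i _; exact: sqr_ge0.
Qed.

Lemma CauchySchwarz_nl a b N : \sum_(1 <= n < N) normc (a n) * normc (b n) <= nl a N * nl b N.
Proof. exact: CauchySchwarz_sum. Qed.

Definition delta (k : nat) : sq := fun n => (n == k)%:R.

Lemma nl_delta k N : (0 < k < N)%N -> nl (delta k) N = 1.
Proof.
move=> h; rewrite /nl /l2partial (bigD1_seq k) /= ?iota_uniq ?mem_index_iota //.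
rewrite /delta eqxx normc1E expr1n big1 ?addr0 ?sqrtr1 // => i /negbTE ->.
by rewrite normc0E expr0n.
Qed.

(** Arbitrary matrices are allowed, because cutting a Hankel matrix into blocks destroys the
    dependence on the product of the indices. *)
Definition kernel := nat -> nat -> C.

Definition kf (G : kernel) a b N : C :=
  \sum_(1 <= n < N) \sum_(1 <= m < N) a n * b m * G n m.

Definition hk (al : sq) : kernel := fun n m => al (n * m)%N.

Definition kbound (G : kernel) (K : R) : Prop :=
  forall a b N, normc (kf G a b N) <= K * nl a N * nl b N.

Lemma eq_kf G H a b c d N :
  (forall n m, (0 < n < N)%N -> (0 < m < N)%N -> a n * b m * G n m = c n * d m * H n m) ->
  kf G a b N = kf H c d N.
Proof. by move=> h; apply: eq_big_nat => n hn; apply: eq_big_nat => m hm; exact: h. Qed.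

Lemma kfDl G a b c N : kf G (fun n => a n + b n) c N = kf G a c N + kf G b c N.
Proof.
rewrite /kf -big_split /=; apply: eq_bigr => n _; rewrite -big_split /=.
by apply: eq_bigr => m _; rewrite !mulrDl.
Qed.

Lemma kfDr G a b c N : kf G a (fun n => b n + c n) N = kf G a b N + kf G a c N.
Proof.
rewrite /kf -big_split /=; apply: eq_bigr => n _; rewrite -big_split /=.
by apply: eq_bigr => m _; rewrite mulrDr mulrDl.
Qed.

Lemma kfD G H a b N : kf (fun n m => G n m + H n m) a b N = kf G a b N + kf H a b N.
Proof.
rewrite /kf -big_split /=; apply: eq_bigr => n _; rewrite -big_split /=.
by apply: eq_bigr => m _; rewrite mulrDr.
Qed.

Lemma kfZ (k : C) G a b N : kf (fun n m => k * G n m) a b N = k * kf G a b N.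
Proof.
rewrite /kf mulr_sumr; apply: eq_bigr => n _; rewrite mulr_sumr; apply: eq_bigr => m _.
by rewrite mulrCA.
Qed.

Lemma kfZl (k : C) G a b N : kf G (fun n => k * a n) b N = k * kf G a b N.
Proof.
rewrite /kf mulr_sumr; apply: eq_bigr => n _; rewrite mulr_sumr; apply: eq_bigr => m _.
by rewrite -!mulrA.
Qed.

Lemma kf_cutl P G a b N :
  kf G a b N = kf G (cut P a) b N + kf G (cut (predC P) a) b N.
Proof.
rewrite -kfDl; apply: eq_kf => n m _ _; congr (_ * _ * _).
by rewrite /cut /=; case: (P n); rewrite ?addr0 ?add0r.
Qed.

Lemma kf_cutr P G a b N :
  kf G a b N = kf G a (cut P b) N + kf G a (cut (predC P) b) N.
Proof.
rewrite -kfDr; apply: eq_kf => n m _ _; congr (_ * _ * _).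
by rewrite /cut /=; case: (P m); rewrite ?addr0 ?add0r.
Qed.

Lemma kf_delta G n m N : (0 < n < N)%N -> (0 < m < N)%N -> kf G (delta n) (delta m) N = G n m.
Proof.
move=> hn hm; rewrite /kf (bigD1_seq n) /= ?iota_uniq ?mem_index_iota //.
rewrite (bigD1_seq m) /= ?iota_uniq ?mem_index_iota // /delta !eqxx !mul1r.
rewrite big1 ?addr0 => [|i /negbTE->]; last by rewrite mulr0 mul0r.
by rewrite big1 ?addr0 // => i /negbTE->; rewrite big1 // => k _; rewrite !mul0r.
Qed.

Lemma kbound_entry G K n m : kbound G K -> (0 < n)%N -> (0 < m)%N -> normc (G n m) <= K.
Proof.
move=> h n0 m0; have := h (delta n) (delta m) (maxn n m).+1.
have hn : (0 < n < (maxn n m).+1)%N by rewrite n0 ltnS leq_maxl.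
have hm : (0 < m < (maxn n m).+1)%N by rewrite m0 ltnS leq_maxr.
by rewrite kf_delta // !nl_delta // !mulr1.
Qed.

Lemma kbound_ge0 G K : kbound G K -> 0 <= K.
Proof. by move=> h; apply: (le_trans _ (kbound_entry (n:=1) (m:=1) h _ _)) => //; exact: normc_ge0. Qed.

Lemma kboundW G K L : K <= L -> kbound G K -> kbound G L.
Proof.
by move=> KL h a b N; apply: (le_trans (h a b N)); rewrite !ler_wpM2r ?nl_ge0.
Qed.

Lemma kboundD G H K L : kbound G K -> kbound H L -> kbound (fun n m => G n m + H n m) (K + L).
Proof.
move=> hG hH a b N; rewrite kfD !mulrDl (le_trans (ler_normcD _ _)) //.
exact: lerD.
Qed.

Lemma kboundZ (k : C) G K : kbound G K -> kbound (fun n m => k * G n m) (normc k * K).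
Proof.
by move=> hG a b N; rewrite kfZ normcM -!mulrA ler_wpM2l ?normc_ge0 // mulrA.
Qed.

Lemma kbound_eq G H K : (forall n m, (0 < n)%N -> (0 < m)%N -> G n m = H n m) ->
  kbound G K -> kbound H K.
Proof.
move=> e h a b N; rewrite (eq_kf (H := G) (c:=a) (d:=b)) // => n m /andP[n0 _] /andP[m0 _].
by rewrite e.
Qed.

Lemma kbound_cut G K P Q : kbound G K ->
  kbound (fun n m => if P n && Q m then G n m else 0) K.
Proof.
move=> h a b N.
rewrite (eq_kf (H := G) (c := cut P a) (d := cut Q b)); last first.
  by move=> n m _ _; rewrite /cut; case: (P n); case: (Q m); rewrite /= ?(mulr0,mul0r).
apply: (le_trans (h _ _ _)); have K0 := kbound_ge0 h.
by rewrite ler_pM ?mulr_ge0 ?nl_ge0 ?nl_cut // ler_wpM2l ?nl_cut.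
Qed.

Lemma MformE al a b N : Mform al a b N = kf (hk al) a (fun m => conjc (b m)) N.
Proof. by []. Qed.

(** Only indices below [N] enter the form, so arguments may be truncated; conjugating the second one
    passes from the sesquilinear to the bilinear form without changing norms. *)
Lemma MboundP al K : Mbound al K <-> kbound (hk al) K.
Proof.
split=> [[K0 h] a b N|h].
  have := h (trunc N a) (fun m => conjc (trunc N b m)) N (trunc_supp _ _).
  have sb : supp_in (fun m => conjc (trunc N b m)) N.
    by have [h0 h1] := trunc_supp N b; split=> [|n /h1 ->]; rewrite ?h0 conjc0.
  move=> /(_ sb); rewrite (l2norm_supp (trunc_supp _ _)) (l2norm_supp sb) nlJ !nl_trunc MformE.
  rewrite (eq_kf (H := hk al) (c := a) (d := b)) // => n m hn hm.
  by rewrite conjcK /trunc /cut hn hm.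
split=> [|a b N sa sb]; first exact: kbound_ge0 h.
by rewrite MformE (l2norm_supp sa) (l2norm_supp sb) -(nlJ b); exact: h.
Qed.

(** The infimum defining [opnorm] is attained, since for fixed [a], [b], [N] the inequality is a
    closed condition on the bound. *)
Lemma opnorm_bound al : inM al -> kbound (hk al) (opnorm al).
Proof.
move=> [_ [K hK]] a b N.
have S0 : [set K | Mbound al K] !=set0 by exists K.
have p0 : 0 <= nl a N * nl b N by rewrite mulr_ge0 ?nl_ge0.
have [p|p] := ltrP 0 (nl a N * nl b N); last first.
  have e : nl a N * nl b N = 0 by apply/le_anti; rewrite p p0.
  by move/MboundP : hK => /(_ a b N); rewrite -!mulrA e !mulr0.
rewrite -mulrA -ler_pdivrMr //; apply: lb_le_inf => // L /= /MboundP/(_ a b N).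
by rewrite ler_pdivrMr // mulrA.
Qed.

Lemma opnorm_ge0 al : 0 <= opnorm al.
Proof.
have [S0|/set0P S0] := eqVneq [set K | Mbound al K] set0; first by rewrite /opnorm S0 inf0.
by apply: lb_le_inf => // K [].
Qed.

Lemma opnorm_le al K : kbound (hk al) K -> opnorm al <= K.
Proof.
by move=> h; apply: ge_inf; [exists 0 => L [] | exact/MboundP].
Qed.

Lemma kbound_inM al K : al 0%N = 0 -> kbound (hk al) K -> inM al.
Proof. by move=> a0 h; split=> //; exists K; exact/MboundP. Qed.

(** For positive [n] the coefficient is the matrix entry in row [n], column 1. *)
Lemma normc_le_opnorm al n : inM al -> normc (al n) <= opnorm al.
Proof.
move=> ha; case: n => [|n]; first by case: ha => -> _; rewrite normc0E opnorm_ge0.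
have := kbound_entry (n := n.+1) (m := 1%N) (opnorm_bound ha).
by rewrite /hk muln1; apply.
Qed.

Lemma inM_lin (k : C) al be : inM al -> inM be -> inM (sq_lin k al be).
Proof.
move=> ha hb; apply: (kbound_inM (K := normc k * opnorm al + opnorm be)).
  by rewrite /sq_lin; case: ha => -> _; case: hb => -> _; rewrite mulr0 addr0.
exact: (kboundD (kboundZ k (opnorm_bound ha)) (opnorm_bound hb)).
Qed.

End Forms.

(** * The Fejer multiplier and tails of kernels *)

Section AdditiveWeight.
Local Open Scope nat_scope.

(* Chosen because it is completely additive with finite level sets. *)
Definition sopfr (n : nat) : nat := \sum_(0 <= p < n.+1) p * logn p n.

Lemma sopfr_widen n N : 0 < n -> n < N -> sopfr n = \sum_(0 <= p < N) p * logn p n.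
Proof.
move=> n0 nN; rewrite (big_cat_nat (n := n.+1) (p := N)) //=.
rewrite [X in _ = _ + X]big_nat_cond [X in _ = _ + X]big1 ?addn0 //.
move=> p /andP[/andP[np _] _].
by rewrite lognE (gtnNdvd n0 np) !andbF muln0.
Qed.

Lemma sopfrM n m : 0 < n -> 0 < m -> sopfr (n * m) = sopfr n + sopfr m.
Proof.
move=> n0 m0; have nm0 : 0 < n * m by rewrite muln_gt0 n0.
have hn : n < (n * m).+1 by rewrite ltnS leq_pmulr.
have hm : m < (n * m).+1 by rewrite ltnS leq_pmull.
rewrite (sopfr_widen n0 hn) (sopfr_widen m0 hm) /sopfr -big_split /=.
by apply: eq_bigr => p _; rewrite lognM // mulnDr.
Qed.

(** Prime by prime, p <= 2^p. This makes the level sets of [sopfr] finite, hence the Fejer weights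
    finitely supported. *)
Lemma leq_exp_sopfr n : 0 < n -> n <= 2 ^ sopfr n.
Proof.
move=> n0; rewrite -{1}(partnT n0) /partn /sopfr expn_sum.
apply: leq_prod => p _; rewrite expnM; case: (logn p n) => // k.
by rewrite leq_exp2r // ltnW // ltn_expl.
Qed.

End AdditiveWeight.

Section Fejer.
Variable R : realType.
Local Notation normc := (@ComplexField.Normc.normc R).
Local Notation C := R[i].
Local Notation sq := (sq R).
Implicit Types (a b c al be : sq) (N T : nat).

(** Natural-number subtraction supplies the positive part; the weight is identically 0 for
    [T = 0]. *)
Definition fejer (T n : nat) : R := (T - sopfr n)%N%:R / T%:R.

Lemma fejer_le1 T n : fejer T n <= 1.
Proof.
case: T => [|T]; first by rewrite /fejer invr0 mulr0 ler01.
by rewrite ler_pdivrMr ?ltr0n // mul1r ler_nat leq_subr.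
Qed.

Lemma fejer_supp T n : (0 < n)%N -> (2 ^ T <= n)%N -> fejer T n = 0.
Proof.
move=> n0 h; rewrite /fejer (_ : (T - sopfr n)%N = 0%N) ?mul0r //.
apply/eqP; rewrite subn_eq0 -(leq_exp2l (m := 2)) //.
exact: leq_trans (leq_exp_sopfr n0).
Qed.

Lemma fejer_cvg M (e : R) : 0 < e ->
  exists T0, forall T n, (T0 <= T)%N -> (n < M)%N -> 1 - fejer T n <= e.
Proof.
(* [L] dominates [sopfr] below [M], so there the weight differs from 1 by at most L / T. *)
move=> e0; pose L := (\sum_(0 <= k < M) sopfr k)%N.
exists (Num.bound (L%:R / e)).+1 => T n hT hn.
have T0 : (0 < T)%N by exact: leq_trans hT.
have hL : (sopfr n <= L)%N.
  rewrite /L (bigD1_seq n) /= ?iota_uniq ?mem_index_iota //; exact: leq_addr.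
have h1 : L%:R / e < T%:R.
  apply: (lt_trans (archi_boundP _)); first by rewrite divr_ge0 // ltW.
  by rewrite ltr_nat.
have T1 : 0 < T%:R :> R by rewrite ltr0n.
rewrite lerBlDl -lerBlDr /fejer ler_pdivlMr // mulrBl mul1r.
move: h1; rewrite ltr_pdivrMr // => h1.
have : (T%:R : R) <= (T - sopfr n)%N%:R + L%:R.
  by rewrite -natrD ler_nat; lia.
by lra.
Qed.

Lemma sum_interval_indicator s U T : (U <= T)%N -> (\sum_(0 <= l < T) (s <= l < U) = U - s)%N.
Proof.
elim: T U => [|T IH] U UT; first by rewrite big_geq //; lia.
rewrite big_nat_recr //=; move: UT; rewrite leq_eqVlt => /orP[/eqP ->|UT].
  rewrite (eq_big_nat _ _ (F2 := fun l => (s <= l < T)%N : nat)); last first.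
    by move=> l hl; congr nat_of_bool; lia.
  by rewrite IH //; case: (leqP s T) => h; rewrite /= ?ltnSn; lia.
by rewrite IH // (_ : (s <= T < U)%N = false) ?addn0 //; lia.
Qed.

(* The Fejer weight of a product is an average of product indicators: this is what makes it
   a contractive multiplier. *)
Lemma fejerM T n m : (0 < n)%N -> (0 < m)%N -> fejer T (n * m) =
  T%:R^-1 * \sum_(0 <= l < T) ((sopfr n <= l)%N && (l < T - sopfr m)%N)%:R.
Proof.
move=> n0 m0; rewrite /fejer mulrC sopfrM // addnC subnDA.
by rewrite -(@sum_interval_indicator (sopfr n) (T - sopfr m) T) ?leq_subr // natr_sum.
Qed.

Definition fmul (T : nat) (al : sq) : sq := fun n => ((fejer T n)%:C)%C * al n.

Lemma fmul_supp T al : al 0%N = 0 -> supp_in (fmul T al) (2 ^ T).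
Proof.
move=> a0; split; first by rewrite /fmul a0 mulr0.
by move=> n h; rewrite /fmul fejer_supp ?mul0r // (leq_trans _ h) // expn_gt0.
Qed.

Lemma kf_fmul T al a b N : kf (hk (fmul T al)) a b N =
  ((T%:R^-1 : R)%:C)%C * \sum_(0 <= l < T)
     kf (hk al) (cut (fun n => sopfr n <= l)%N a) (cut (fun m => l < T - sopfr m)%N b) N.
Proof.
rewrite [in RHS]/kf; under eq_bigr => l _ do rewrite /kf.
rewrite exchange_big mulr_sumr /=; apply: eq_big_nat => n /andP[n0 _].
rewrite exchange_big mulr_sumr /=; apply: eq_big_nat => m /andP[m0 _].
rewrite /hk /fmul fejerM // rmorphM /= rmorph_sum /=.
set t := (_%:C)%C; set S := \sum_(0 <= l < T) _.
have -> : a n * b m * (t * S * al (n * m)%N) = t * (S * (a n * b m * al (n * m)%N)) by ring.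
congr (_ * _); rewrite mulr_suml; apply: eq_bigr => l _.
rewrite /cut; case: (_ <= l)%N; case: (l < _)%N => /=; rewrite ?(mul0r, mulr0, rmorph0) //.
by rewrite rmorph1 mul1r.
Qed.

(** By [kf_fmul] the form is an average of T forms, each the original one at cut arguments, whose
    norms do not increase. *)
Lemma kbound_fmul T al K : kbound (hk al) K -> kbound (hk (fmul T al)) K.
Proof.
move=> h a b N; have K0 := kbound_ge0 h.
case: T => [|T].
  rewrite kf_fmul big_geq // mulr0 normc0E; by rewrite !mulr_ge0 ?nl_ge0.
rewrite kf_fmul normcM normc_real ger0_norm ?invr_ge0 // mulrC ler_pdivrMr ?ltr0n //.
apply: (le_trans (normc_sum _ _ _)).
rewrite mulr_natr -[X in _ *+ X]subn0 -sumr_const_nat; apply: ler_sum => l _.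
apply: (le_trans (h _ _ _)).
by rewrite ler_pM ?mulr_ge0 ?nl_ge0 ?nl_cut // ler_wpM2l ?nl_cut.
Qed.

End Fejer.

Section Tails.
Variable R : realType.
Local Notation normc := (@ComplexField.Normc.normc R).
Local Notation C := R[i].
Local Notation sq := (sq R).
Implicit Types (a b c al be f : sq) (N T : nat) (G H B : kernel R).

(** Once a partial sum is within [e] of the supremum of all of them, at most [e] is left for the
    tail. *)
Lemma l2_tail f (K : R) : (forall N, l2partial f N <= K) -> forall e, 0 < e ->
  exists N0, forall N, l2partial (cut (leq N0) f) N <= e.
Proof.
move=> fK e e0; pose S := [set l2partial f N | N in [set: nat]].
have hS : has_sup S by split; [exists (l2partial f 0), 0%N | exists K => _ [N _ <-]].
have [_ [N0 _ <-] hN0] := sup_adherent e0 hS.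
exists N0 => N; pose M := maxn N N0.
have hM : l2partial f M <= sup S by apply: ub_le_sup; [case: hS|exists M].
apply: (le_trans (l2partial_le _ (leq_maxl N N0))); rewrite -/M.
have := sqr_nl_cut (leq N0) f M; rewrite !sqr_nl => e1.
have h2 : l2partial f N0 <= l2partial (cut (predC (leq N0)) f) M.
  apply: (le_trans _ (l2partial_le _ (leq_maxr N N0))).
  rewrite (@eq_l2partial _ _ f) // => n /andP[_ hn].
  by rewrite /cut /= -ltnNge hn.
by rewrite -/S in hN0; lra.
Qed.

Lemma sum_le_nat_mul (F : nat -> R) (N0 : nat) (c : R) N : 0 <= c ->
  (forall n, (0 < n < N)%N -> (n < N0)%N -> F n <= c) ->
  (forall n, (0 < n < N)%N -> (N0 <= n)%N -> F n <= 0) ->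
  \sum_(1 <= n < N) F n <= N0%:R * c.
Proof.
(* The sharper count with the minimum of [N] and [N0] is what passes through the induction on
   [N]. *)
move=> c0 h1 h2; suff : \sum_(1 <= n < N) F n <= (minn N N0)%:R * c.
  by move/le_trans; apply; rewrite ler_wpM2r // ler_nat geq_minr.
elim: N h1 h2 => [|N IH] h1 h2; first by rewrite big_geq // mulr_ge0.
have {}IH : \sum_(1 <= n < N) F n <= (minn N N0)%:R * c.
  by apply: IH => n /andP[n0 nN]; [apply: h1|apply: h2]; rewrite n0 ltnS ltnW.
have [N1|N1] := leqP 1 N; last by rewrite big_geq // mulr_ge0.
rewrite big_nat_recr //=; have [NN|NN] := ltnP N N0.
  rewrite (_ : minn N.+1 N0 = (minn N N0).+1); last by lia.
  by rewrite -natr1 mulrDl mul1r lerD // h1 // N1 /=.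
rewrite (_ : minn N.+1 N0 = minn N N0); last by lia.
by rewrite -[leRHS]addr0 lerD // h2 // N1 /=.
Qed.

(** Compactness expressed by forms: the form is uniformly small as soon as one argument lives beyond
    [N0]. For Hankel kernels in M it is equivalent to [Mcompact] (see [inM0P]), and it also makes
    sense for the non-Hankel hooks. *)
Definition ktail G : Prop := forall e : R, 0 < e -> exists N0, forall a b N,
  ((forall n, (n < N0)%N -> a n = 0) \/ (forall n, (n < N0)%N -> b n = 0)) ->
  normc (kf G a b N) <= e * nl a N * nl b N.

Lemma ktailD G H : ktail G -> ktail H -> ktail (fun n m => G n m + H n m).
Proof.
move=> hG hH e e0; have e2 : 0 < e / 2 by rewrite divr_gt0.
have [N1 h1] := hG _ e2; have [N2 h2] := hH _ e2.
exists (maxn N1 N2) => a b N h; rewrite kfD (le_trans (ler_normcD _ _)) //.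
rewrite [e in leRHS](_ : e = e / 2 + e / 2); last by field.
rewrite 2!mulrDl lerD //.
  by apply: h1; case: h => h; [left|right] => n hn; apply: h; rewrite (leq_trans hn) ?leq_maxl.
by apply: h2; case: h => h; [left|right] => n hn; apply: h; rewrite (leq_trans hn) ?leq_maxr.
Qed.

Lemma ktailZ (k : C) G : ktail G -> ktail (fun n m => k * G n m).
Proof.
move=> hG e e0; have k0 := normc_ge0 k.
have k1 : 0 < normc k + 1 by lra.
have [N0 h] := hG _ (divr_gt0 e0 k1); exists N0 => a b N hab.
rewrite kfZ normcM (le_trans (ler_wpM2l k0 (h a b N hab))) // !mulrA.
rewrite !ler_wpM2r ?nl_ge0 // ler_pdivrMr // mulrC ler_pM2l //; lra.
Qed.

Lemma ktail_eq G H : (forall n m, (0 < n)%N -> (0 < m)%N -> G n m = H n m) ->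
  ktail G -> ktail H.
Proof.
move=> e h d d0; have [N0 hN] := h d d0; exists N0 => a b N hab.
rewrite (eq_kf (H := G) (c := a) (d := b)); first exact: hN.
by move=> n m /andP[n0 _] /andP[m0 _]; rewrite e.
Qed.

Lemma ktail_fsupp G N0 :
  (forall n m, (0 < n)%N -> (0 < m)%N -> (N0 <= n)%N || (N0 <= m)%N -> G n m = 0) -> ktail G.
Proof.
move=> h e e0; exists N0 => a b N hab.
rewrite /kf big_nat_cond big1 ?normc0E ?mulr_ge0 ?nl_ge0 ?(ltW e0) //.
move=> n /andP[/andP[n0 _] _]; rewrite big_nat_cond big1 // => m /andP[/andP[m0 _] _].
have [h1|h1] := boolP ((N0 <= n)%N || (N0 <= m)%N); first by rewrite h // mulr0.
move: h1; rewrite negb_or -!ltnNge => /andP[h1 h2].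
by case: hab => hab; rewrite ?(hab n) ?(hab m) // ?(mul0r, mulr0).
Qed.

Lemma kf_tr G a b N : kf (fun n m => G m n) a b N = kf G b a N.
Proof.
rewrite /kf exchange_big /=; apply: eq_bigr => n _; apply: eq_bigr => m _.
by rewrite [b n * _]mulrC.
Qed.

Lemma kbound_tr G K : kbound G K -> kbound (fun n m => G m n) K.
Proof. by move=> h a b N; rewrite kf_tr (le_trans (h _ _ _)) // mulrAC. Qed.

Lemma ktail_tr G : ktail G -> ktail (fun n m => G m n).
Proof.
move=> h e e0; have [N0 hN] := h e e0; exists N0 => a b N hab.
by rewrite kf_tr mulrAC; apply: hN; case: hab; [right|left].
Qed.

Lemma kf_pointl G k a b N : (0 < k < N)%N ->
  kf (fun n m => if n == k then G n m else 0) a b N = a k * \sum_(1 <= m < N) b m * G k m.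
Proof.
move=> hk; rewrite /kf (bigD1_seq k) /= ?iota_uniq ?mem_index_iota // eqxx.
rewrite [X in _ + X]big1 ?addr0 => [|i /negbTE ->]; last by rewrite big1 // => m _; rewrite mulr0.
by rewrite mulr_sumr; apply: eq_bigr => m _; rewrite mulrA.
Qed.

Lemma kf_pointl0 G k a b N : ~~ (0 < k < N)%N ->
  kf (fun n m => if n == k then G n m else 0) a b N = 0.
Proof.
move=> hk; rewrite /kf big_nat_cond big1 // => n /andP[hn _].
by rewrite big1 // => m _; case: eqP => [e|]; rewrite ?mulr0 //; rewrite e in hn; rewrite hn in hk.
Qed.

(** The form is tested on the basis vector [k] and the conjugate of row [k]. *)
Lemma kbound_row G K k N : kbound G K -> (0 < k)%N -> nl (G k) N <= K.
Proof.
move=> h k0; pose M := maxn N k.+1.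
have kM : (0 < k < M)%N by rewrite k0 leq_maxr.
have : nl (G k) M <= K.
  have := h (delta R k) (fun m => conjc (G k m)) M.
  have -> : kf G (delta R k) (fun m => conjc (G k m)) M = ((nl (G k) M ^+ 2)%:C)%C.
    rewrite sqr_nl /l2partial rmorph_sum /= /kf (bigD1_seq k) /= ?iota_uniq ?mem_index_iota //.
    rewrite [X in _ + X]big1 ?addr0 => [|i /negbTE hi]; last first.
      by rewrite big1 // => m _; rewrite /delta hi !mul0r.
    by apply: eq_bigr => m _; rewrite /delta eqxx mul1r mulrC mulcJ_normc.
  rewrite normc_real ger0_norm ?sqr_ge0 // nl_delta // mulr1 nlJ.
  have n0 := nl_ge0 (G k) M; have K0 := kbound_ge0 h.
  by rewrite expr2; have [p|p] := ltrP 0 (nl (G k) M); [rewrite ler_pM2r | move=> _; lra].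
by apply: le_trans; rewrite /nl ler_sqrt ?l2partial_ge0 // l2partial_le ?leq_maxl.
Qed.

(** A single row is square summable by [kbound_row], so its tail is small; and the form vanishes if
    [a] starts beyond [k]. *)
Lemma ktail_pointl G K k : kbound G K -> (0 < k)%N ->
  ktail (fun n m => if n == k then G n m else 0).
Proof.
move=> h k0 e e0.
have K0 := kbound_ge0 h.
have hb N : l2partial (G k) N <= K ^+ 2.
  by rewrite -sqr_nl ler_pXn2r ?nnegrE ?nl_ge0 // kbound_row.
have e2 : 0 < e ^+ 2 by rewrite exprn_gt0.
have [N1 hN1] := l2_tail hb e2.
exists (maxn N1 k.+1) => a b N hab.
have [hk|hk] := boolP (0 < k < N)%N; last first.
  by rewrite kf_pointl0 // normc0E !mulr_ge0 ?nl_ge0 // ltW.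
rewrite kf_pointl // normcM; case: hab => hab.
  by rewrite hab ?leq_maxr // normc0E mul0r !mulr_ge0 ?nl_ge0 // ltW.
rewrite [e * _]mulrC -[leRHS]mulrA ler_pM ?normc_ge0 ?normc_le_nl //.
apply: (le_trans (normc_sum _ _ _)).
rewrite (eq_bigr (fun m => normc (b m) * normc (cut (leq N1) (G k) m))); last first.
  move=> m _; rewrite normcM /cut; case: leqP => // hm.
  by rewrite hab ?normc0E ?mul0r // (leq_trans hm) ?leq_maxl.
apply: (le_trans (CauchySchwarz_nl _ _ _)).
rewrite mulrC ler_wpM2r ?nl_ge0 // -[leRHS]ger0_norm ?(ltW e0) // -sqrtr_sqr.
by rewrite ler_sqrt ?sqr_ge0.
Qed.

Lemma ktail_rows G K N0 : kbound G K -> ktail (fun n m => if (n < N0)%N then G n m else 0).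
Proof.
move=> h; elim: N0 => [|N0 IH]; first by apply: (ktail_fsupp (N0 := 0)).
case: N0 IH => [|N0] IH.
  (* Row 0 never enters a form, as the sums start at 1. *)
  by apply: (ktail_eq _ IH) => -[|n] m.
apply: (ktail_eq _ (ktailD IH (ktail_pointl h (ltn0Sn N0)))) => n m n0 m0 /=.
have [->|hn] := eqVneq n N0.+1; first by rewrite ltnn ltnSn add0r.
by rewrite addr0 [in RHS]ltnS [in RHS]leq_eqVlt (negbTE hn).
Qed.

Lemma ktail_cols G K N0 : kbound G K -> ktail (fun n m => if (m < N0)%N then G n m else 0).
Proof. by move=> h; apply: ktail_tr (ktail_rows N0 (kbound_tr h)). Qed.

Lemma normc_kf_block B (N0 : nat) (d : R) a b N : 0 <= d ->
  (forall n m, (0 < n < N0)%N -> (0 < m < N0)%N -> normc (B n m) <= d) ->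
  normc (kf B (cut (gtn N0) a) (cut (gtn N0) b) N) <= N0%:R * (N0%:R * d) * nl a N * nl b N.
Proof.
move=> d0 h; pose q := nl a N * nl b N * d.
have q0 : 0 <= q by rewrite !mulr_ge0 ?nl_ge0.
have -> : N0%:R * (N0%:R * d) * nl a N * nl b N = N0%:R * (N0%:R * q) by rewrite /q; ring.
rewrite /kf (le_trans (normc_sum _ _ _)) //.
apply: sum_le_nat_mul; first by rewrite mulr_ge0.
  move=> n hn hn0; rewrite (le_trans (normc_sum _ _ _)) //.
  apply: sum_le_nat_mul => // m hm hm0.
    rewrite /cut /= hn0 hm0 !normcM /q.
    have h1 : (0 < n < N0)%N by rewrite hn0 andbT; case/andP: hn.
    have h2 : (0 < m < N0)%N by rewrite hm0 andbT; case/andP: hm.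
    by rewrite ler_pM ?mulr_ge0 ?normc_ge0 ?h // ler_pM ?normc_ge0 ?normc_le_nl.
  by rewrite /cut /= [(m < N0)%N]ltnNge hm0 /= mulr0 mul0r normc0E.
move=> n hn hn0; rewrite big1 ?normc0E // => m _.
by rewrite /cut /= [(n < N0)%N]ltnNge hn0 /= !mul0r.
Qed.

(* In the block decomposition at N0, G + B is dominated by the 2x2 matrix
   [[K, A], [A, A]], whose Frobenius norm is taken as the bound. *)
Lemma hook_step G (K A : R) (M : nat) : kbound G K -> ktail G -> 0 < A ->
  exists N0 (d : R), [/\ (M <= N0)%N, 0 < d & forall B, kbound B A ->
    (forall n m, (0 < n < N0)%N -> (0 < m < N0)%N -> normc (B n m) <= d) ->
    kbound (fun n m => G n m + B n m) (Num.sqrt (K ^+ 2 + 13%:R * A ^+ 2))].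
Proof.
move=> hG tG A0; have K0 := kbound_ge0 hG.
(* This [h] satisfies (K + h)^2 <= K^2 + A^2 and (A + h)^2 <= 4 A^2. One block of the first kind and
   three of the second add up to K^2 + 13 A^2. *)
pose h := A ^+ 2 / (2%:R * K + 2%:R * A).
have D0 : 0 < 2%:R * K + 2%:R * A by lra.
have h0 : 0 < h by rewrite divr_gt0 // exprn_gt0.
have eh : h * (2%:R * K + 2%:R * A) = A ^+ 2 by rewrite /h mulfVK // gt_eqF.
have hA : h <= A by nra.
have hK : h * (2%:R * K + h) <= A ^+ 2 by nra.
clearbody h; have [N1 t1] := tG h h0; pose N0 := maxn M N1; pose n0 : R := N0%:R + 1.
have n0p : 0 < n0 by rewrite ltr_wpDl.
have n0N : N0%:R <= n0 by rewrite lerDl.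
clearbody n0.
(* The block below [N0] has fewer than n0^2 entries, so entries of size h / n0^2 give it norm at
   most [h]. *)
exists N0, (h / (n0 * n0)); split; [exact: leq_maxl|exact: divr_gt0 h0 (mulr_gt0 n0p n0p)|].
move=> B hB sB a b N.
set p := nl (cut (gtn N0) a) N; set r := nl (cut (predC (gtn N0)) a) N.
set q := nl (cut (gtn N0) b) N; set s := nl (cut (predC (gtn N0)) b) N.
have p0 : 0 <= p := nl_ge0 _ _; have r0 : 0 <= r := nl_ge0 _ _.
have q0 : 0 <= q := nl_ge0 _ _; have s0 : 0 <= s := nl_ge0 _ _.
have van (x : sq) n : (n < N1)%N -> cut (predC (gtn N0)) x n = 0.
  by move=> hn; rewrite /cut /= (leq_trans hn (leq_maxr _ _)).
rewrite !kfD (kf_cutl (gtn N0) G) (kf_cutl (gtn N0) B).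
rewrite !(kf_cutr (gtn N0) _ _ b).
have g1 := hG (cut (gtn N0) a) (cut (gtn N0) b) N.
have g2 := t1 (cut (gtn N0) a) (cut (predC (gtn N0)) b) N (or_intror (van b)).
have g3 := t1 (cut (predC (gtn N0)) a) (cut (gtn N0) b) N (or_introl (van a)).
have g4 := t1 (cut (predC (gtn N0)) a) (cut (predC (gtn N0)) b) N (or_introl (van a)).
have b1 : normc (kf B (cut (gtn N0) a) (cut (gtn N0) b) N) <= h * p * q.
  have idem (x : sq) : cut (gtn N0) (cut (gtn N0) x) = cut (gtn N0) x.
    by apply/funext => n; rewrite /cut; case: (gtn N0 n).
  rewrite -[cut _ a]idem -[cut _ b]idem.
  have dp : 0 <= h / (n0 * n0) by rewrite divr_ge0 ?mulr_ge0 ?(ltW h0) ?(ltW n0p).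
  apply: (le_trans (normc_kf_block _ _ _ dp sB)); rewrite -/p -/q.
  rewrite !ler_wpM2r // !mulrA ler_pdivrMr ?mulr_gt0 // [leRHS]mulrC.
  by rewrite ler_wpM2r ?(ltW h0) // ler_pM.
have b2 := hB (cut (gtn N0) a) (cut (predC (gtn N0)) b) N.
have b3 := hB (cut (predC (gtn N0)) a) (cut (gtn N0) b) N.
have b4 := hB (cut (predC (gtn N0)) a) (cut (predC (gtn N0)) b) N.
rewrite -/p -/q -/r -/s in g1 g2 g3 g4 b1 b2 b3 b4.
have t4 (x1 x2 x3 x4 : C) : normc (x1 + x2 + (x3 + x4)) <=
    normc x1 + normc x2 + (normc x3 + normc x4).
  by rewrite (le_trans (ler_normcD _ _)) // lerD // ler_normcD.
apply: (le_trans (ler_normcD _ _)); apply: (le_trans (lerD (t4 _ _ _ _) (t4 _ _ _ _))).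
(* The four blocks are collected in the shape of an expanded list sum, whence the trailing 0. *)
apply: (@le_trans _ _ ((K + h) * (p * q) +
    ((A + h) * (p * s) + ((A + h) * (r * q) + ((A + h) * (r * s) + 0))))); first by lra.
(* The squares of the second factors sum to (p^2 + r^2)(q^2 + s^2), the squared product of the full
   norms. *)
have := CauchySchwarz_sum
  [:: (K + h, p * q); (A + h, p * s); (A + h, r * q); (A + h, r * s)] xpredT fst snd.
rewrite !big_cons !big_nil /= => /le_trans; apply; rewrite -mulrA ler_pM ?sqrtr_ge0 //.
  rewrite ler_sqrt; last by have := sqr_ge0 K; have := sqr_ge0 A; lra.
  by nra.
rewrite -[leRHS]ger0_norm ?mulr_ge0 ?nl_ge0 // -sqrtr_sqr ler_sqrt ?sqr_ge0 //.
rewrite [leRHS]exprMn (sqr_nl_cut (gtn N0) a) (sqr_nl_cut (gtn N0) b) -/p -/q -/r -/s.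
by rewrite le_eqVlt; apply/orP; left; apply/eqP; ring.
Qed.

End Tails.

(** * Compactness *)

Section Compactness.
Variable R : realType.
Local Notation normc := (@ComplexField.Normc.normc R).
Local Notation C := R[i].
Local Notation sq := (sq R).
Implicit Types (a b c al be f : sq) (N T : nat).

Lemma real_net (K d : R) : 0 < d ->
  exists s : seq R, forall x, `|x| <= K -> exists2 w, w \in s & `|x - w| <= d.
Proof.
move=> d0; exists [seq - K + i%:R * d | i <- iota 0 (Num.bound (2%:R * K / d)).+1] => x xK.
have [x1 x2] : - K <= x /\ x <= K by apply/andP; rewrite -ler_norml.
have K0 : 0 <= K by lra.
have y0 : 0 <= (x + K) / d by rewrite divr_ge0 ?(ltW d0) //; lra.
exists (- K + (Num.truncn ((x + K) / d))%:R * d).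
  apply: (map_f (fun i => - K + i%:R * d)); rewrite mem_iota /= add0n ltnS.
  have h : (Num.truncn ((x + K) / d))%:R <= (x + K) / d by rewrite truncn_le.
  rewrite -(ler_nat R) (le_trans h) //.
  rewrite ltW // (le_lt_trans _ (archi_boundP _)) ?divr_ge0 ?mulr_ge0 ?(ltW d0) //.
  by rewrite ler_pM2r ?invr_gt0 //; lra.
have /andP[h1 h2] := truncn_itv y0.
move: h1 h2; rewrite ler_pdivlMr // ltr_pdivrMr // mulrSr [(_ + 1) * d]mulrDl mul1r => h1 h2.
by rewrite ler_norml; apply/andP; split; lra.
Qed.

Lemma complex_net (K d : R) : 0 < d ->
  exists s : seq C, forall z, normc z <= K -> exists2 w, w \in s & normc (z - w) <= d.
Proof.
move=> d0; have [s hs] := real_net K (divr_gt0 d0 (ltr0Sn _ 1)).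
exists [seq Complex u v | u <- s, v <- s] => z zK.
have [u us hu] := hs _ (le_trans (Re_le_normc z) zK).
have [v vs hv] := hs _ (le_trans (Im_le_normc z) zK).
exists (Complex u v); first exact: allpairs_f.
apply: (le_trans (normc_le_ReIm _)); case: z {zK} hu hv => x y /= hu hv.
by rewrite [d](_ : _ = d / 2 + d / 2) ?lerD //; field.
Qed.

(** Built one coordinate at a time. Members of the net vanish from [N0] on, so that tails can be
    treated separately. *)
Lemma sq_net (N0 : nat) (K d : R) : 0 < d -> exists fs : seq sq, forall y : sq,
  (forall n, normc (y n) <= K) -> exists f, [/\ f \in fs,
    forall n, (n < N0)%N -> normc (y n - f n) <= d & forall n, (N0 <= n)%N -> f n = 0].
Proof.
move=> d0; elim: N0 => [|N0 [fs hfs]].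
  by exists [:: fun=> 0] => y _; exists (fun=> 0); split; rewrite ?inE.
have [s hs] := complex_net K d0.
exists [seq (fun n => if n == N0 then w else f n) : sq | f <- fs, w <- s] => y yK.
have [f [ffs h1 h2]] := hfs y yK; have [w ws hw] := hs _ (yK N0).
exists (fun n => if n == N0 then w else f n); split.
- by apply/allpairsP; exists (f, w).
- by move=> n; rewrite ltnS leq_eqVlt; case: eqP => [->|] //= _ /h1.
- by move=> n hn; rewrite gtn_eqF // h2 // ltnW.
Qed.

Lemma supp_inW a N M : (N <= M)%N -> supp_in a N -> supp_in a M.
Proof. by move=> NM [a0 h]; split=> // n hn; apply: h; exact: leq_trans hn. Qed.

Lemma nl_supp a N M : (N <= M)%N -> supp_in a N -> nl a M = nl a N.
Proof. by move=> NM sa; rewrite -(l2norm_supp sa) (l2norm_supp (supp_inW NM sa)). Qed.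

Lemma nl_truncW a N M : (N <= M)%N -> nl (trunc N a) M = nl a N.
Proof. by move=> NM; rewrite (nl_supp NM (trunc_supp _ _)) nl_trunc. Qed.

Lemma sum_supp (F : nat -> C) N M : (N <= M)%N -> (forall n, (N <= n)%N -> F n = 0) ->
  \sum_(1 <= n < M) F n = \sum_(1 <= n < N) F n.
Proof.
move=> NM h; have [N1|N1] := leqP 1 N.
  rewrite (big_cat_nat (n := N) (p := M)) //= [X in _ + X]big_nat_cond [X in _ + X]big1 ?addr0 //.
  by move=> n /andP[/andP[hn _] _]; exact: h.
rewrite [RHS]big_geq ?(ltnW N1) // big_nat_cond big1 // => n _; apply: h.
by move: N1; rewrite ltnS leqn0 => /eqP ->.
Qed.

Lemma sum_trunc a (F : nat -> C) N M : (N <= M)%N ->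
  \sum_(1 <= n < M) trunc N a n * F n = \sum_(1 <= n < N) a n * F n.
Proof.
move=> NM; rewrite (sum_supp NM); last first.
  by move=> n hn; rewrite (proj2 (trunc_supp N a)) // mul0r.
by apply: eq_big_nat => n hn; rewrite /trunc /cut hn.
Qed.

Lemma kf_Mapply al a b N P : (N <= P)%N ->
  kf (hk al) (trunc N a) b P = \sum_(1 <= m < P) Mapply al a N m * b m.
Proof.
move=> NP; rewrite /kf exchange_big /=; apply: eq_big_nat => m /andP[m0 _].
rewrite /Mapply gtn_eqF // mulr_suml.
transitivity (\sum_(1 <= n < P) trunc N a n * (al (n * m)%N * b m)).
  by apply: eq_bigr => n _; rewrite mulrAC mulrA.
by rewrite (sum_trunc a _ NP); apply: eq_bigr => n _; rewrite mulrA.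
Qed.

(* Duality: the vector M(al) a is tested against its own conjugate. *)
Lemma nl_Mapply al (Q : pred nat) (L : R) a N M : 0 <= L ->
  (forall b P, (forall n, ~~ Q n -> b n = 0) ->
     normc (kf (hk al) (trunc N a) b P) <= L * nl (trunc N a) P * nl b P) ->
  nl (cut Q (Mapply al a N)) M <= L * nl a N.
Proof.
move=> L0 h; pose y := cut Q (Mapply al a N).
pose b := trunc M (fun m => conjc (y m)); pose P := maxn N M.
have hb n : ~~ Q n -> b n = 0.
  by move=> /negbTE q; rewrite /b /trunc /cut; case: ifP => // _; rewrite /y /cut q conjc0.
have := h b P hb; rewrite kf_Mapply ?leq_maxl //.
have -> : \sum_(1 <= m < P) Mapply al a N m * b m = ((nl y M ^+ 2)%:C)%C.
  under eq_bigr => m _ do rewrite mulrC.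
  rewrite sum_trunc ?leq_maxr // sqr_nl /l2partial rmorph_sum /=.
  apply: eq_bigr => m _; rewrite -mulcJ_normc /y /cut.
  by case: (Q m); rewrite ?conjc0 ?mul0r // mulrC.
rewrite normc_real ger0_norm ?sqr_ge0 // !nl_truncW ?leq_maxl ?leq_maxr // nlJ expr2.
have [p|p] := ltrP 0 (nl y M); first by rewrite ler_pM2r.
by move=> _; rewrite (le_trans p) // mulr_ge0 ?nl_ge0.
Qed.

Lemma kf_hkC al a b N : kf (hk al) a b N = kf (hk al) b a N.
Proof. by rewrite -kf_tr; apply: eq_kf => n m _ _; rewrite /hk mulnC. Qed.

Lemma ktail_hk al : (forall e : R, 0 < e -> exists N0, forall a b N,
  (forall n, (n < N0)%N -> b n = 0) -> normc (kf (hk al) a b N) <= e * nl a N * nl b N) ->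
  ktail (hk al).
Proof.
move=> h e e0; have [N0 hN] := h e e0; exists N0 => a b N [] hab; last exact: hN.
by rewrite kf_hkC mulrAC; apply: hN.
Qed.

(** A finite net has uniformly small tails beyond some [N0], and image vectors inherit this up to
    the mesh of the net; the form at [a], [b] pairs the image of [a] with [b]. *)
Lemma Mcompact_ktail al : inM al -> Mcompact al -> ktail (hk al).
Proof.
move=> ha hc; apply: ktail_hk => e e0.
have hK := opnorm_bound ha; set K := opnorm al in hK; have K0 : 0 <= K := opnorm_ge0 _.
have e2 : 0 < e / 2 by rewrite divr_gt0.
have [fs hfs] := hc _ e2.
(* Members of the net may lie outside l2, so boundedness is a premise; it holds for any member close
   to an image vector. *)
have [N0 hN0] : exists N0, forall f, f \in fs -> (exists B, forall M, l2partial f M <= B) ->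
    forall M, l2partial (cut (leq N0) f) M <= (e / 2) ^+ 2.
  elim: fs {hfs} => [|f fs [N1 h1]]; first by exists 0%N.
  have [N2 h2] : exists N2, (exists B, forall M, l2partial f M <= B) ->
    forall M, l2partial (cut (leq N2) f) M <= (e / 2) ^+ 2.
    have [[B hB]|nB] := pselect (exists B, forall M, l2partial f M <= B); last by exists 0%N.
    have [N2 hN2] := l2_tail hB (exprn_gt0 2 e2); by exists N2.
  exists (maxn N1 N2) => g; rewrite inE => gfs gB M.
  have mono N3 : (N3 <= maxn N1 N2)%N ->
      l2partial (cut (leq (maxn N1 N2)) g) M <= l2partial (cut (leq N3) g) M.
    move=> h3; rewrite -!sqr_nl ler_pXn2r ?nnegrE ?nl_ge0 //; apply: le_nl => n _.
    rewrite /cut; case: ifP => [h4|_]; first by rewrite (leq_trans h3 h4).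
    by rewrite normc0E normc_ge0.
  case/orP: gfs => [/eqP gf|gfs].
    by apply: (le_trans (mono N2 (leq_maxr _ _))); rewrite gf; apply: h2; rewrite -gf.
  by apply: (le_trans (mono N1 (leq_maxl _ _))); exact: h1.
exists N0 => a b N hb.
have [s0|s0] := lerP (nl a N) 0.
  have -> : nl a N = 0 by apply/le_anti; rewrite s0 nl_ge0.
  have := hK a b N; have -> : nl a N = 0 by apply/le_anti; rewrite s0 nl_ge0.
  by rewrite !mulr0 !mul0r.
set s := nl a N in s0 *.
pose a' : sq := fun n => ((s^-1)%:C)%C * a n.
have na' : nl a' N = 1 by rewrite nl_scale normc_real ger0_norm ?invr_ge0 ?(ltW s0) // mulVf ?gt_eqF.
have la' : l2norm (trunc N a') <= 1 by rewrite (l2norm_supp (trunc_supp _ _)) nl_trunc na'.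
have [f ffs [_ hf]] := hfs _ N (trunc_supp _ _) la'.
have -> : kf (hk al) a b N = (s%:C)%C * kf (hk al) (trunc N (trunc N a')) b N.
  rewrite -kfZl; apply: eq_kf => n m hn hm; congr (_ * _ * _).
  by rewrite /trunc /cut hn /a' mulrA -rmorphM /= mulfV ?gt_eqF // mul1r.
rewrite kf_Mapply // normcM normc_real ger0_norm ?(ltW s0) // [e * s]mulrC -[leRHS]mulrA.
rewrite ler_wpM2l ?(ltW s0) //.
set y := Mapply _ _ _ in hf *.
have yK M : l2partial y M <= K ^+ 2.
  rewrite -sqr_nl ler_pXn2r ?nnegrE ?nl_ge0 //.
  have := @nl_Mapply al xpredT K (trunc N a') N M K0 (fun b P _ => hK _ _ _).
  by rewrite nl_trunc na' mulr1.
have fB : exists B, forall M, l2partial f M <= B.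
  exists (2 * K ^+ 2 + 2 * (e / 2) ^+ 2) => M.
  apply: (le_trans _ (lerD (ler_wpM2l _ (yK M)) (ler_wpM2l _ (hf M)))) => //.
  rewrite /l2partial !mulr_sumr -big_split /=; apply: ler_sum => m _.
  have := ler_normcB (y m) (y m - f m); rewrite subKr => h1.
  have := normc_ge0 (f m); have := normc_ge0 (y m); have := normc_ge0 (y m - f m).
  move: h1; set u := normc (f m); set v := normc (y m); set w := normc (y m - f m) => h1 w0 v0 u0.
  have : u ^+ 2 <= (v + w) ^+ 2 by rewrite ler_pXn2r ?nnegrE ?addr_ge0.
  have := sqr_ge0 (v - w); nra.
have -> : e * nl b N = e / 2 * nl b N + e / 2 * nl b N by field.
rewrite (eq_bigr (fun m => (y m - f m) * b m + f m * b m)); last by move=> m _; rewrite -mulrDl subrK.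
rewrite big_split /= (le_trans (ler_normcD _ _)) // lerD //.
  apply: (le_trans (normc_sum _ _ _)); under eq_bigr => m _ do rewrite normcM.
  apply: (le_trans (CauchySchwarz_nl (fun m => y m - f m) b N)); rewrite ler_wpM2r ?nl_ge0 //.
  by rewrite -[leRHS]ger0_norm ?(ltW e2) // -sqrtr_sqr ler_sqrt ?sqr_ge0.
apply: (le_trans (normc_sum _ _ _)).
rewrite (eq_bigr (fun m => normc (cut (leq N0) f m) * normc (b m))); last first.
  move=> m _; rewrite normcM /cut; case: leqP => // hm.
  by rewrite hb // normc0E !mulr0.
apply: (le_trans (CauchySchwarz_nl _ b N)); rewrite ler_wpM2r ?nl_ge0 //.
by rewrite -[leRHS]ger0_norm ?(ltW e2) // -sqrtr_sqr ler_sqrt ?sqr_ge0 // hN0.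
Qed.

(** Beyond [N0] the image vectors are small by duality; their first coordinates are bounded and
    admit a finite net. *)
Lemma ktail_Mcompact al : inM al -> ktail (hk al) -> Mcompact al.
Proof.
move=> ha ht e e0.
have hK := opnorm_bound ha; set K := opnorm al in hK; have K0 : 0 <= K := opnorm_ge0 _.
have e2 : 0 < e / 2 by rewrite divr_gt0.
have [N0 hN0] := ht _ e2.
(* Errors of size [d] in the coordinates below [N0] then have l2 norm at most e / 2. *)
pose d := e / 2 / (N0%:R + 1).
have n1 : 0 < N0%:R + 1 :> R by rewrite ltr_wpDl.
have d0 : 0 < d by rewrite divr_gt0.
have ed : d * (N0%:R + 1) = e / 2 by rewrite /d mulfVK ?gt_eqF.
clearbody d.
have [fs hfs] := sq_net N0 K d0.
exists fs => a N sa na; set y := Mapply al a N.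
have na1 : nl a N <= 1 by rewrite -(l2norm_supp sa).
have yQ Q L M : 0 <= L -> (forall b P, (forall n, ~~ Q n -> b n = 0) ->
     normc (kf (hk al) (trunc N a) b P) <= L * nl (trunc N a) P * nl b P) ->
     nl (cut Q y) M <= L.
  by move=> L0 h; rewrite (le_trans (nl_Mapply M L0 h)) // -[leRHS]mulr1 ler_wpM2l.
have yK n : normc (y n) <= K.
  case: n => [|n]; first by rewrite normc0E.
  have hn : (0 < n.+1 < n.+2)%N by rewrite ltnSn.
  apply: (le_trans (normc_le_nl y hn)); apply: (yQ xpredT) => // b P _; exact: hK.
have [f [ffs h1 h2]] := hfs y yK; exists f => //; split; first exact: ltW.
move=> M.
have := sqr_nl_cut (leq N0) (fun m => y m - f m) M; rewrite sqr_nl => ->.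
have t1 : nl (cut (leq N0) (fun m => y m - f m)) M <= e / 2.
  rewrite (@eq_nl _ _ (cut (leq N0) y)); last first.
    by move=> n _; rewrite /cut; case: ifP => // hn; rewrite h2 // subr0.
  apply: yQ; first exact: ltW.
  by move=> b P hb; apply: hN0; right => n hn; apply: hb; rewrite -ltnNge.
have t2 : l2partial (cut (predC (leq N0)) (fun m => y m - f m)) M <= N0%:R * d ^+ 2.
  apply: sum_le_nat_mul; first exact: sqr_ge0.
    move=> n _ hn; rewrite /cut /= -ltnNge hn ler_pXn2r ?nnegrE ?normc_ge0 ?(ltW d0) //.
    exact: h1.
  by move=> n _ hn; rewrite /cut ifF ?normc0E ?expr0n //= hn.
rewrite -sqr_nl in t2.
have t3 : nl (cut (leq N0) (fun m => y m - f m)) M ^+ 2 <= (e / 2) ^+ 2.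
  by rewrite ler_pXn2r ?nnegrE ?nl_ge0 ?(ltW e2).
have t4 : N0%:R * d ^+ 2 <= (e / 2) ^+ 2.
  rewrite -ed; have : 0 <= N0%:R :> R by []. 
  by nra.
have := sqr_ge0 e; lra.
Qed.

Lemma inM0P al : inM0 al <-> inM al /\ ktail (hk al).
Proof.
split=> -[ha h]; split=> //; [exact: Mcompact_ktail|exact: ktail_Mcompact].
Qed.

Lemma inM0_lin (k : C) al be : inM0 al -> inM0 be -> inM0 (sq_lin k al be).
Proof.
move=> /inM0P[ha ta] /inM0P[hb tb]; apply/inM0P; split; first exact: inM_lin.
exact: ktailD (ktailZ k ta) tb.
Qed.

Lemma sum_indicator_le1 (k N : nat) : \sum_(1 <= m < N) (m == k)%:R <= 1 :> R.
Proof.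
have [hk|hk] := boolP (0 < k < N)%N.
  rewrite (bigD1_seq k) /= ?iota_uniq ?mem_index_iota // eqxx.
  by rewrite [X in _ + X]big1 ?addr0 // => m /negbTE ->.
rewrite big_nat_cond big1 ?ler01 // => m /andP[hm _].
by case: eqP => // e; rewrite e in hm; rewrite hm in hk.
Qed.

Lemma sum_divisor_pairs a k N :
  \sum_(1 <= n < N) \sum_(1 <= m < N) ((n * m == k)%N%:R * normc (a n)) ^+ 2 <= l2partial a N.
Proof.
rewrite /l2partial big_nat_cond [leRHS]big_nat_cond; apply: ler_sum => n /andP[/andP[n0 _] _].
under eq_bigr => m _ do rewrite exprMn.
rewrite -mulr_suml ler_piMl ?sqr_ge0 //.
apply: (le_trans _ (sum_indicator_le1 (k %/ n) N)); apply: ler_sum => m _.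
case: eqP => [<-|_]; last by rewrite expr0n.
by rewrite mulKn // eqxx expr1n.
Qed.

(** The matrix is a partial permutation: Cauchy-Schwarz over the pairs with product [k] meets each
    row and each column at most once. *)
Lemma kbound_delta k : kbound (hk (delta R k)) 1.
Proof.
move=> a b N; rewrite mul1r.
apply: (@le_trans _ _ (\sum_(p <- [seq (n, m) | n <- index_iota 1 N, m <- index_iota 1 N])
   ((p.1 * p.2 == k)%N%:R * normc (a p.1)) * ((p.1 * p.2 == k)%N%:R * normc (b p.2)))).
  rewrite big_allpairs_dep /=; apply: (le_trans (normc_sum _ _ _)); apply: ler_sum => n _.
  apply: (le_trans (normc_sum _ _ _)); apply: ler_sum => m _.
  rewrite !normcM /hk /delta; case: eqP => _; last by rewrite normc0E !mul0r !mulr0.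
  by rewrite normc1E !mul1r mulr1.
apply: (le_trans (CauchySchwarz_sum _ _ _ _)); rewrite !big_allpairs_dep /=.
rewrite ler_pM ?sqrtr_ge0 // ler_sqrt ?l2partial_ge0 ?sum_divisor_pairs //.
rewrite exchange_big /= (le_trans _ (sum_divisor_pairs b k N)) //.
by under eq_bigr => n _ do under eq_bigr => m _ do rewrite mulnC.
Qed.

Lemma inM_delta k : (0 < k)%N -> inM (delta R k).
Proof.
by move=> k0; apply: (kbound_inM _ (kbound_delta k)); rewrite /delta ltn_eqF.
Qed.

Lemma inM_fsupp al : fsupp al -> inM al.
Proof.
move=> [N0]; elim: N0 al => [|N0 IH] al [a0 h].
  apply: (kbound_inM (K := 0)) => // a b N; rewrite !mul0r /kf big1 ?normc0E // => n _.
  by rewrite big1 // => m _; rewrite /hk h // mulr0.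
case: N0 IH h => [|N0] IH h; first by apply: IH; split=> // -[|n] // _; apply: h.
have -> : al = sq_lin (al N0.+1) (delta R N0.+1) (trunc N0.+1 al).
  apply/funext => n; rewrite /sq_lin /delta /trunc /cut.
  case: (ltngtP n N0.+1) => hn; rewrite ?andbT ?andbF ?mulr0 ?add0r.
  - by case: n hn => [|n] _.
  - by rewrite h.
  - by rewrite hn mulr1 addr0.
by apply: inM_lin; [exact: inM_delta | apply: IH; exact: trunc_supp].
Qed.

Lemma inM0_fsupp al : fsupp al -> inM0 al.
Proof.
move=> [N0 [a0 h]]; apply/inM0P; split; first by apply: inM_fsupp; exists N0.
apply: (ktail_fsupp (N0 := N0)) => n m n0 m0 hnm; apply: h; rewrite /hk.
by case/orP: hnm => /leq_trans; apply; rewrite ?leq_pmulr ?leq_pmull.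
Qed.

End Compactness.

(** * Dirichlet convolution and the space X *)

Section Convolution.
Variable R : realType.
Local Notation normc := (@ComplexField.Normc.normc R).
Local Notation C := R[i].
Local Notation sq := (sq R).
Implicit Types (a b c d al be : sq) (N T : nat).

Lemma fsupp_lin (k : C) c d : fsupp c -> fsupp d -> fsupp (sq_lin k c d).
Proof.
move=> [N [c0 hc]] [M [d0 hd]]; exists (maxn N M); split; first by rewrite /sq_lin c0 d0 mulr0 addr0.
by move=> n; rewrite geq_max /sq_lin => /andP[h1 h2]; rewrite hc // hd // mulr0 addr0.
Qed.

Lemma fsupp0 : fsupp (fun=> 0 : C).
Proof. by exists 0%N. Qed.

Lemma fsupp_delta k : (0 < k)%N -> fsupp (delta R k).
Proof.
move=> k0; exists k.+1; split; first by rewrite /delta ltn_eqF.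
by move=> n hn; rewrite /delta gtn_eqF.
Qed.

Lemma fsupp_fmul T c : c 0%N = 0 -> fsupp (fmul T c).
Proof. by move=> c0; exists (2 ^ T)%N; exact: fmul_supp. Qed.

Lemma fsupp_at0 c : fsupp c -> c 0%N = 0.
Proof. by case=> N []. Qed.

(** [fbound] picks an unspecified support bound; any other one gives the same value. *)
Lemma pairE al c N : supp_in c N -> pair al c = \sum_(1 <= n < N) al n * c n.
Proof.
move=> sc; have h : supp_in c (fbound c).
  by rewrite /fbound; case: pselect => [h|[]]; [exact: projT2 (cid h)|exists N].
rewrite /pair -(sum_supp (leq_maxl (fbound c) N)).
  by rewrite (sum_supp (leq_maxr (fbound c) N)) // => n hn; rewrite (proj2 sc) // mulr0.
by move=> n hn; rewrite (proj2 h) // mulr0.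
Qed.

Lemma pair_linl (k : C) al be c : pair (sq_lin k al be) c = k * pair al c + pair be c.
Proof.
rewrite /pair mulr_sumr -big_split /=; apply: eq_bigr => n _.
by rewrite /sq_lin mulrDl mulrA.
Qed.

Lemma fsupp2 c d : fsupp c -> fsupp d -> exists N, supp_in c N /\ supp_in d N.
Proof.
move=> [N hc] [M hd]; exists (maxn N M).
by split; [apply: supp_inW hc; exact: leq_maxl|apply: supp_inW hd; exact: leq_maxr].
Qed.

Lemma pair_linr (k : C) al c d : fsupp c -> fsupp d ->
  pair al (sq_lin k c d) = k * pair al c + pair al d.
Proof.
move=> fc fd; have [N [hc hd]] := fsupp2 fc fd.
have h : supp_in (sq_lin k c d) N.
  split; first by rewrite /sq_lin (proj1 hc) (proj1 hd) mulr0 addr0.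
  by move=> n hn; rewrite /sq_lin (proj2 hc) // (proj2 hd) // mulr0 addr0.
rewrite (pairE _ h) (pairE _ hc) (pairE _ hd) mulr_sumr -big_split /=.
by apply: eq_bigr => n _; rewrite /sq_lin mulrDr mulrCA.
Qed.

(** Turns the divisor sum into a sum over a square of index pairs, the shape shared by bilinear
    forms and [fejerM]. Both sides vanish at [k = 0]. *)
Lemma dconvE a b N k : supp_in a N -> supp_in b N -> dconv a b k =
  \sum_(1 <= n < N) \sum_(1 <= m < N) (if (n * m == k)%N then a n * conjc (b m) else 0).
Proof.
move=> sa sb; have [->|k0] := posnP k.
  rewrite /dconv big_geq // big_nat_cond big1 // => n /andP[/andP[n0 _] _].
  rewrite big_nat_cond big1 // => m /andP[/andP[m0 _] _].
  by rewrite muln_eq0 !gtn_eqF.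
transitivity (\sum_(1 <= n < N) (if (n %| k)%N then a n * conjc (b (k %/ n)%N) else 0)).
  rewrite /dconv big_mkcond /= -(sum_supp (leq_maxl k.+1 N)); last first.
    by move=> n hn; rewrite gtnNdvd.
  rewrite (sum_supp (leq_maxr k.+1 N)) // => n hn.
  by rewrite (proj2 sa) // mul0r if_same.
apply: eq_big_nat => n /andP[n0 _]; case: ifPn => [/dvdnP[q kq]|ndv]; last first.
  by rewrite big1 // => m _; case: eqP => // e; rewrite -e dvdn_mulr in ndv.
rewrite kq mulnK //; have q0 : (0 < q)%N by move: k0; rewrite kq; case: (q).
under eq_bigr => m _ do rewrite mulnC eqn_pmul2r //.
have [qN|Nq] := ltnP q N.
  rewrite (bigD1_seq q) /= ?iota_uniq ?mem_index_iota ?q0 // eqxx.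
  by rewrite big1 ?addr0 // => m /negbTE ->.
rewrite (proj2 sb) // conjc0 mulr0 big_nat_cond big1 // => m /andP[/andP[_ mN] _].
by rewrite ltn_eqF // (leq_trans mN).
Qed.

Lemma dconv_supp a b N : supp_in a N -> supp_in b N -> supp_in (dconv a b) (N * N).
Proof.
move=> sa sb; split=> [|k hk]; first by rewrite /dconv big_geq.
rewrite (dconvE k sa sb) big_nat_cond big1 // => n /andP[/andP[n0 nN] _].
rewrite big_nat_cond big1 // => m /andP[/andP[m0 mN] _].
by rewrite ltn_eqF // (leq_trans _ hk) // ltn_mul.
Qed.

Lemma fsupp_dconv a b : fsupp a -> fsupp b -> fsupp (dconv a b).
Proof. by move=> fa fb; have [N [sa sb]] := fsupp2 fa fb; exists (N * N)%N; exact: dconv_supp. Qed.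

(** The source of the duality between X and M: pairing with a convolution is a matrix coefficient of
    the operator. *)
Lemma pair_dconv al a b N : supp_in a N -> supp_in b N ->
  pair al (dconv a b) = Mform al a b N.
Proof.
move=> sa sb; rewrite (pairE _ (dconv_supp sa sb)).
under eq_bigr => k _ do rewrite (dconvE k sa sb) mulr_sumr.
rewrite exchange_big /=; apply: eq_big_nat => n /andP[n0 nN].
under eq_bigr => k _ do rewrite mulr_sumr.
rewrite exchange_big /=; apply: eq_big_nat => m /andP[m0 mN].
have nm : (0 < n * m < N * N)%N by rewrite muln_gt0 n0 m0 ltn_mul.
rewrite (bigD1_seq (n * m)%N) /= ?iota_uniq ?mem_index_iota // eqxx mulrC.
by rewrite [X in _ + X]big1 ?addr0 // => k; rewrite eq_sym => /negbTE ->; rewrite mulr0.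
Qed.

Lemma conv_sum_cons p s : conv_sum (p :: s) = sq_lin 1 (dconv p.1 p.2) (conv_sum s) :> sq.
Proof. by apply/funext => n; rewrite /conv_sum /sq_lin big_cons mul1r. Qed.

Lemma fsupp_conv_sum (s : seq (sq * sq)) :
  (forall p, p \in s -> fsupp p.1 /\ fsupp p.2) -> fsupp (conv_sum s).
Proof.
elim: s => [|p s IH] h.
  rewrite (_ : conv_sum [::] = fun=> 0); first exact: fsupp0.
  by apply/funext => n; rewrite /conv_sum big_nil.
rewrite conv_sum_cons; apply: fsupp_lin.
  by have [] := h p (mem_head _ _); exact: fsupp_dconv.
by apply: IH => q qs; apply: h; rewrite inE qs orbT.
Qed.

Lemma dconv_delta1 c : fsupp c -> dconv c (delta R 1) = c.
Proof.
move=> fc; apply/funext => k; rewrite /dconv; case: k => [|k].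
  by rewrite big_geq // fsupp_at0.
rewrite big_mkcond (bigD1_seq k.+1) ?mem_index_iota ?ltnSn //; last exact: iota_uniq.
rewrite dvdnn divnn ltn0Sn /delta eqxx conjc1 mulr1 big1 ?[LHS]addr0 // => n nk.
case: ifPn => // /dvdnP[q e]; rewrite e.
have n0 : (0 < n)%N by case: n {nk} e => //; rewrite muln0.
rewrite mulnK //; case: eqP => [q1|_]; last by rewrite conjc0 mulr0.
by move: nk; rewrite e q1 mul1n eqxx.
Qed.

(** Convolution with the unit [delta R 1] shows that, as a set, X consists of all finitely supported
    sequences. *)
Lemma inXP c : inX c <-> fsupp c.
Proof.
split=> [[s [h ->]]|fc]; first exact: fsupp_conv_sum.
exists [:: (c, delta R 1)]; split.
  by move=> p; rewrite inE => /eqP -> /=; split => //; exact: fsupp_delta.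
by apply/funext => n; rewrite /conv_sum big_seq1 dconv_delta1.
Qed.

Lemma inX_lin (k : C) c d : inX c -> inX d -> inX (sq_lin k c d).
Proof. by move=> /inXP hc /inXP hd; apply/inXP; exact: fsupp_lin. Qed.

Lemma normc_pair_conv_sum al K (s : seq (sq * sq)) : kbound (hk al) K ->
  (forall p, p \in s -> fsupp p.1 /\ fsupp p.2) ->
  normc (pair al (conv_sum s)) <= K * \sum_(p <- s) l2norm p.1 * l2norm p.2.
Proof.
move=> hK; elim: s => [|p s IH] h.
  rewrite (@pairE _ _ 0) ?big_geq ?normc0E ?big_nil ?mulr0 //.
  by split=> *; rewrite /conv_sum big_nil.
have hs q : q \in s -> fsupp q.1 /\ fsupp q.2 by move=> qs; apply: h; rewrite inE qs orbT.
have [f1 f2] := h p (mem_head _ _).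
rewrite conv_sum_cons pair_linr; [|exact: fsupp_dconv|exact: fsupp_conv_sum].
rewrite mul1r big_cons mulrDr (le_trans (ler_normcD _ _)) // lerD //; last exact: IH.
have [N [s1 s2]] := fsupp2 f1 f2.
rewrite (pair_dconv _ s1 s2) MformE (l2norm_supp s1) (l2norm_supp s2) -(nlJ p.2) mulrA.
exact: hK.
Qed.

Lemma normX_le_rep c s : is_rep c s -> normX c <= \sum_(p <- s) l2norm p.1 * l2norm p.2.
Proof.
move=> h; apply: ge_inf; last by exists s.
by exists 0 => _ [t _ <-]; apply: sumr_ge0 => p _; rewrite mulr_ge0 ?l2norm_ge0.
Qed.

Lemma normX_ge0 c : 0 <= normX c.
Proof.
rewrite /normX; set S := image _ _.
have [S0|/set0P S0] := eqVneq S set0; first by rewrite S0 inf0.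
by apply: lb_le_inf => // _ [t _ <-]; apply: sumr_ge0 => p _; rewrite mulr_ge0 ?l2norm_ge0.
Qed.

Lemma normc_pair_le al K c : kbound (hk al) K -> inX c -> normc (pair al c) <= K * normX c.
Proof.
move=> hK [s0 r0]; have K0 := kbound_ge0 hK.
have hs s : is_rep c s -> normc (pair al c) <= K * \sum_(p <- s) l2norm p.1 * l2norm p.2.
  by move=> [h ->]; exact: normc_pair_conv_sum.
have [Kp|Kp] := ltrP 0 K; last first.
  have K00 : K = 0 by apply/le_anti; rewrite Kp K0.
  by have := hs _ r0; rewrite K00 !mul0r.
rewrite mulrC -ler_pdivrMr //; apply: lb_le_inf; first by exists (\sum_(p <- s0) l2norm p.1 * l2norm p.2), s0.
by move=> _ [s rs <-]; rewrite ler_pdivrMr // mulrC; exact: hs.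
Qed.

(** The average in [fejerM] is an explicit representation of the weighted convolution by T
    convolutions of cut sequences, with the factor 1 / T put into the first one. *)
Lemma normX_fmul_dconv T a b : fsupp a -> fsupp b ->
  normX (fmul T (dconv a b)) <= l2norm a * l2norm b.
Proof.
move=> fa fb; have [N [sa sb]] := fsupp2 fa fb.
pose u l : sq := fun n => ((T%:R^-1 : R)%:C)%C * cut (fun n => sopfr n <= l)%N a n.
pose v l : sq := cut (fun m => l < T - sopfr m)%N b.
have su l : supp_in (u l) N.
  by split=> [|n hn]; rewrite /u /cut ?(proj1 sa) ?(proj2 sa) // if_same mulr0.
have sv l : supp_in (v l) N.
  by split=> [|n hn]; rewrite /v /cut ?(proj1 sb) ?(proj2 sb) // if_same.
have rep : is_rep (fmul T (dconv a b)) [seq (u l, v l) | l <- index_iota 0 T].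
  split=> [p /mapP[l _ ->] /=|]; first by split; exists N.
  apply/funext => k; rewrite /fmul (dconvE k sa sb) /conv_sum big_map.
  under [RHS]eq_bigr => l _ do rewrite /= (dconvE k (su l) (sv l)).
  rewrite [RHS]exchange_big mulr_sumr /=; apply: eq_big_nat => n /andP[n0 _].
  rewrite [RHS]exchange_big mulr_sumr /=; apply: eq_big_nat => m /andP[m0 _].
  case: eqP => [<-|_]; last by rewrite mulr0 big1.
  rewrite fejerM // rmorphM /= rmorph_sum /= -mulrA mulr_suml mulr_sumr.
  apply: eq_bigr => l _; rewrite /u /v /cut.
  case: (sopfr n <= l)%N; case: (l < T - sopfr m)%N; rewrite [(_ && _)]/=.
  - by rewrite rmorph1 mul1r mulrA.
  - by rewrite rmorph0 conjc0 mul0r !mulr0.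
  - by rewrite rmorph0 mul0r !mulr0 mul0r.
  - by rewrite rmorph0 mul0r !mulr0 mul0r.
apply: (le_trans (normX_le_rep rep)); rewrite big_map /=.
have p0 : 0 <= l2norm a * l2norm b by rewrite mulr_ge0 ?l2norm_ge0.
case: T @u @v su sv rep => [|T] u v su sv rep; first by rewrite big_geq.
apply: (@le_trans _ _ (\sum_(0 <= l < T.+1) T.+1%:R^-1 * (l2norm a * l2norm b))).
  apply: ler_sum => l _; rewrite (l2norm_supp (su l)) (l2norm_supp (sv l)).
  rewrite (l2norm_supp sa) (l2norm_supp sb) mulrA ler_pM ?nl_ge0 ?nl_cut //.
  by rewrite nl_scale normc_real ger0_norm ?invr_ge0 // ler_wpM2l ?invr_ge0 ?nl_cut.
by rewrite sumr_const_nat subn0 -[leLHS]mulr_natl mulrA mulfV ?mul1r // pnatr_eq0.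
Qed.

End Convolution.

(** * Norming functionals *)

Section HahnBanach.
Variables (R : realType) (E : lmodType R[i]).
Local Notation C := R[i].
Implicit Types (p q : E -> R) (x y e : E).

(** Sublinearity over the reals; the complex structure enters only in [sublinear_scalec]. *)
Definition sublinear p :=
  (forall x y, p (x + y) <= p x + p y) /\
  (forall (t : R) x, 0 <= t -> p ((t%:C)%C *: x) <= t * p x).

Lemma sublinear0 p : sublinear p -> p 0 = 0.
Proof.
move=> [pD pZ]; have := pD 0 0; have := pZ 0 0 (lexx 0).
by rewrite scaler0 addr0; lra.
Qed.

Lemma sublinear_opp p x : sublinear p -> - p (- x) <= p x.
Proof. by move=> sp; have [pD _] := sp; have := pD x (- x); rewrite subrr sublinear0 //; lra. Qed.

(* Instead of extending functionals, the gauge itself is lowered to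
   [x |-> inf_(t >= 0) (p (x + t e) - t p e)], which is linear along [e]. *)
Lemma sublinear_lower p e : sublinear p ->
  exists q, [/\ sublinear q, forall x, q x <= p x & q (- e) <= - p e].
Proof.
move=> sp; have [pD pZ] := sp.
pose S x := [set p (x + (t%:C)%C *: e) - t * p e | t in [set t : R | 0 <= t]].
have S0 x : S x !=set0 by exists (p (x + (0%:C)%C *: e) - 0 * p e), 0 => //=.
have Slb x : lbound (S x) (- p (- x)).
  move=> _ [t /= t0 <-]; have := pD (x + (t%:C)%C *: e) (- x).
  have h := pZ t e t0; have h2 := sublinear_opp ((t%:C)%C *: e) sp.
  rewrite addrAC subrr add0r => h3.
  have := pZ t (- e) t0.
  (* Homogeneity is assumed only as an upper bound; scaling back by the inverse of [t] gives the
     reverse one. *)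
  suff : t * p e <= p ((t%:C)%C *: e) by lra.
  have [->|tn] := eqVneq t 0; first by rewrite mul0r scale0r sublinear0.
  have tp : 0 < t by rewrite lt_def tn.
  have ti : 0 <= t^-1 by rewrite invr_ge0.
  have := pZ t^-1 ((t%:C)%C *: e) ti.
  rewrite scalerA -rmorphM /= mulVf // scale1r => h4.
  by rewrite mulrC -ler_pdivlMr // mulrC.
have hS x : has_inf (S x) by split=> //; exists (- p (- x)); exact: Slb.
exists (fun x => inf (S x)); split.
- split=> [x y|t x].
    rewrite -lerBlDr; apply: lb_le_inf => // _ [s /= s0 <-].
    rewrite lerBlDl -lerBlDr; apply: lb_le_inf => // _ [t /= t0 <-].
    rewrite lerBlDr; apply: (@le_trans _ _ (p (x + y + ((s + t)%:C)%C *: e) - (s + t) * p e)).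
      by apply: ge_inf; [case: (hS (x + y))|exists (s + t) => //=; exact: addr_ge0].
    have := pD (x + (s%:C)%C *: e) (y + (t%:C)%C *: e).
    rewrite addrACA -scalerDl -rmorphD /=; lra.
  rewrite le_eqVlt => /orP[/eqP <-|t0].
    rewrite scale0r mul0r; apply: (@le_trans _ _ (p (0 + (0%:C)%C *: e) - 0 * p e)).
      by apply: ge_inf; [case: (hS 0)|exists 0 => /=].
    by rewrite scale0r addr0 sublinear0 // mul0r subr0.
  rewrite mulrC -ler_pdivrMr //; apply: lb_le_inf => // _ [s /= s0 <-].
  rewrite ler_pdivrMr //.
  apply: (@le_trans _ _ (p ((t%:C)%C *: x + ((t * s)%:C)%C *: e) - (t * s) * p e)).
    by apply: ge_inf; [case: (hS ((t%:C)%C *: x))|exists (t * s) => //=; rewrite mulr_ge0 // ltW].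
  have := pZ t (x + (s%:C)%C *: e) (ltW t0).
  rewrite scalerDr scalerA -rmorphM /=; lra.
- move=> x; apply: (@le_trans _ _ (p (x + (0%:C)%C *: e) - 0 * p e)).
    by apply: ge_inf; [case: (hS x)|exists 0 => /=].
  by rewrite scale0r addr0 mul0r subr0.
(* The choice [t = 1] in the infimum at [- e]. *)
- apply: (@le_trans _ _ (p (- e + (1%:C)%C *: e) - 1 * p e)).
    by apply: ge_inf; [case: (hS (- e))|exists 1 => //=].
  by rewrite scale1r addNr sublinear0 // mul1r sub0r.
Qed.

(** One lowering per vector suffices: linearity along [e] is an upper bound at [- e] against a value
    dominating [q e], and it persists when [q] decreases further. *)
Lemma sublinear_lower_seq p (es : seq E) : sublinear p -> exists q,
  [/\ sublinear q, forall x, q x <= p x & forall e, e \in es -> q (- e) <= - q e].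
Proof.
elim: es p => [|e es IH] p sp; first by exists p.
have [q1 [s1 l1 h1]] := sublinear_lower e sp.
have [q [sq lq hq]] := IH q1 s1; exists q; split => //.
  by move=> x; exact: le_trans (lq x) (l1 x).
move=> f; rewrite inE => /orP[/eqP ->|]; last exact: hq.
by have := lq (- e); have := lq e; have := l1 e; lra.
Qed.

Lemma sublinear_addl p e x : sublinear p -> p (- e) <= - p e -> p (x + e) = p x + p e.
Proof.
move=> [pD _] he; apply/le_anti/andP; split; first exact: pD.
by have := pD (x + e) (- e); rewrite addrK; lra.
Qed.

Lemma sublinear_scalel p e (t : R) : sublinear p -> p (- e) <= - p e ->
  p ((t%:C)%C *: e) = t * p e /\ p (- ((t%:C)%C *: e)) <= - p ((t%:C)%C *: e).
Proof.
move=> sp he; have [pD pZ] := sp.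
have h0 : p (- e) = - p e by apply/le_anti; rewrite he /=; have := sublinear_opp e sp; lra.
have pos s : 0 <= s -> p ((s%:C)%C *: e) = s * p e /\ p (- ((s%:C)%C *: e)) = - (s * p e).
  move=> s0; have h1 := pZ s e s0; have := pZ s (- e) s0; rewrite scalerN h0 => h2.
  by have := sublinear_opp ((s%:C)%C *: e) sp; split; lra.
have [t0|t0] := lerP 0 t; first by have [-> ->] := pos t t0.
have tn : 0 <= - t by lra.
have := pos _ tn; rewrite rmorphN /= scaleNr opprK => -[-> ->].
by split; lra.
Qed.

(** Real linearity along [e] and along i times [e] makes [p] the real part of a complex functional,
    by the usual formula p(e) - i p(ie). *)
Lemma sublinear_scalec p e x (z : C) : sublinear p -> p (- e) <= - p e ->
  p (- ('i%C *: e)) <= - p ('i%C *: e) ->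
  p (x + z *: e) = p x + complex.Re (z * (p e -i* p ('i%C *: e))%C).
Proof.
move=> sp he hie; rewrite {1}[z]complexE scalerDl addrA [_ * (_%:C)%C]mulrC -scalerA.
have [h1 h2] := sublinear_scalel (complex.Re z) sp he.
have [h3 h4] := sublinear_scalel (complex.Im z) sp hie.
rewrite sublinear_addl // sublinear_addl // h1 h3.
by case: z {h1 h2 h3 h4} => a b /=; ring.
Qed.

End HahnBanach.

Section RealNorm.
Variables (R : realType) (V : normedModType R[i]).
Local Notation normc := (@ComplexField.Normc.normc R).
Implicit Types u v : V.

(** The norm of a complex normed module is complex valued; its real part gives access to real
    arithmetic. *)
Definition nv (v : V) : R := complex.Re `|v|.

Lemma nvE v : `|v| = ((nv v)%:C)%C.
Proof. by rewrite /nv RRe_real // normr_real. Qed.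

Lemma nv_ge0 v : 0 <= nv v.
Proof. by rewrite -ler0c -nvE. Qed.

Lemma nvD u v : nv (u + v) <= nv u + nv v.
Proof. by rewrite -lecR rmorphD /= -!nvE ler_normD. Qed.

Lemma nvZ k v : nv (k *: v) = normc k * nv v.
Proof. by apply: complexI; rewrite rmorphM /= -!nvE -normc_norm normrZ. Qed.

Lemma nv_distC u v : nv (u - v) = nv (v - u).
Proof. by rewrite /nv distrC. Qed.

Lemma nv_distD w u v : nv (u - v) <= nv (u - w) + nv (w - v).
Proof. by rewrite (le_trans _ (nvD _ _)) // addrA subrK. Qed.

Lemma nv0 : nv 0 = 0.
Proof. by rewrite /nv normr0. Qed.

Lemma nv_sum (I : Type) (r : seq I) (P : pred I) (F : I -> V) :
  nv (\sum_(i <- r | P i) F i) <= \sum_(i <- r | P i) nv (F i).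
Proof.
elim/big_rec2: _ => [|i y x _ le]; first by rewrite nv0.
by rewrite (le_trans (nvD _ _)) // lerD2l.
Qed.

Lemma nv_sublinear : sublinear nv.
Proof.
split=> [|t x t0]; first exact: nvD.
by rewrite nvZ normc_real ger0_norm.
Qed.

End RealNorm.

Section LinearOnFinite.
Variables (R : realType) (W : lmodType R[i]) (f : sq R -> W).
Hypothesis f_lin : forall (k : R[i]) (c d : sq R), fsupp c -> fsupp d ->
  f (sq_lin k c d) = k *: f c + f d.

Lemma fsupp_linear0 : f (fun=> 0) = 0.
Proof.
have := f_lin (-1) (fsupp0 R) (fsupp0 R); rewrite scaleN1r addNr => <-; congr f.
by apply/funext => n; rewrite /sq_lin mulr0 addr0.
Qed.

(** The target is arbitrary because this serves the embedding [j], functionals on M_0 and elements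
    of the bidual alike. *)
Lemma fsupp_linear_sum c N : supp_in c N -> f c = \sum_(1 <= n < N) c n *: f (delta R n).
Proof.
elim: N c => [|N IH] c [c0 h].
  by rewrite big_geq // (_ : c = fun=> 0) ?fsupp_linear0 //; apply/funext => n; exact: h.
case: N IH h => [|N] IH h.
  by rewrite big_geq // (_ : c = fun=> 0) ?fsupp_linear0 //; apply/funext => -[|n] //; exact: h.
have e : c = sq_lin (c N.+1) (delta R N.+1) (trunc N.+1 c).
  apply/funext => n; rewrite /sq_lin /delta /trunc /cut.
  case: (ltngtP n N.+1) => hn; rewrite ?andbT ?andbF ?mulr0 ?add0r.
  - by case: n hn => [|n] _.
  - by rewrite h.
  - by rewrite hn mulr1 addr0.
rewrite {1}e f_lin; [|exact: fsupp_delta|by exists N.+1; exact: trunc_supp].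
rewrite [RHS]big_nat_recr //= [LHS]addrC (IH _ (trunc_supp _ _)); congr (_ + _).
by apply: eq_big_nat => n hn; rewrite /trunc /cut hn.
Qed.

End LinearOnFinite.

Section Norming.
Variables (R : realType) (V : normedModType R[i]) (j : sq R -> V).
Hypothesis j_lin : forall (k : R[i]) (c d : sq R), inX c -> inX d ->
  j (sq_lin k c d) = k *: j c + j d.
Hypothesis j_isom : forall c : sq R, inX c -> `|j c| = ((normX c)%:C)%C.
Local Notation normc := (@ComplexField.Normc.normc R).
Local Notation C := R[i].
Local Notation sq := (sq R).
Implicit Types (a b c d al be : sq) (N T : nat).

Lemma nv_j c : inX c -> nv (j c) = normX c.
Proof. by move=> hc; rewrite /nv j_isom. Qed.

Lemma j0 : j (fun=> 0) = 0.
Proof. by apply: fsupp_linear0 => k c d /inXP hc /inXP hd; exact: j_lin. Qed.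

Lemma j_sum c N : supp_in c N -> j c = \sum_(1 <= n < N) c n *: j (delta R n).
Proof. by apply: fsupp_linear_sum => k d e /inXP hd /inXP he; exact: j_lin. Qed.

Lemma j_fmul_near c (e : R) : inX c -> 0 < e ->
  exists T0, forall T, (T0 <= T)%N -> nv (j c - j (fmul T c)) <= e.
Proof.
move=> /inXP [N sc] e0.
pose S := \sum_(1 <= n < N) normc (c n) * nv (j (delta R n)).
have S0 : 0 <= S by apply: sumr_ge0 => n _; rewrite mulr_ge0 ?normc_ge0 ?nv_ge0.
have S1 : 0 < S + 1 by rewrite ltr_wpDl.
have [T0 hT0] := fejer_cvg N (divr_gt0 e0 S1); exists T0 => T hT.
have sf : supp_in (fmul T c) N.
  by split=> [|n hn]; rewrite /fmul ?(proj1 sc) ?(proj2 sc) // mulr0.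
rewrite (j_sum sc) (j_sum sf) -sumrB (le_trans (nv_sum _ _ _)) //.
apply: (@le_trans _ _ (e / (S + 1) * S)); last first.
  by rewrite mulrAC ler_pdivrMr // ler_pM2l // lerDl.
rewrite /S mulr_sumr big_nat_cond [leRHS]big_nat_cond.
apply: ler_sum => n /andP[/andP[n0 nN] _].
rewrite -scalerBl nvZ mulrA ler_wpM2r ?nv_ge0 // /fmul -{1}[c n]mul1r -mulrBl normcM.
have -> : 1 - ((fejer R T n)%:C)%C = ((1 - fejer R T n)%:C)%C by rewrite rmorphB rmorph1.
rewrite ler_wpM2r ?normc_ge0 // normc_real.
by rewrite ger0_norm ?subr_ge0 ?fejer_le1 // hT0.
Qed.

(* The functional is built on the range of the Fejer multiplier, so that it is represented
   by a finitely supported sequence and hence by a compact operator. *)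
Lemma norming_functional c (e : R) : inX c -> 0 < e -> exists al,
  [/\ fsupp al, kbound (hk al) 1 & normX c - e <= normc (pair al c)].
Proof.
move=> hc e0; have [T hT] := j_fmul_near hc e0; have {}hT := hT T (leqnn T).
pose N := (2 ^ T)%N.
(* Lowering along this vector v first gives q(-v) <= -||v||, which survives the later lowerings and
   forces q(v) >= ||v||. *)
have [q1 [s1 l1 h1]] := sublinear_lower (j (fmul T c)) (@nv_sublinear R V).
(* Each basis vector is accompanied by its multiple by i, as needed for complex scalars. *)
pose es := flatten [seq [:: j (delta R n); 'i%C *: j (delta R n)] | n <- index_iota 1 N].
have [q [sq lq hq]] := sublinear_lower_seq es s1.
have hes n : (0 < n < N)%N -> j (delta R n) \in es /\ 'i%C *: j (delta R n) \in es.
  move=> hn; split; apply/flatten_mapP; exists n; rewrite ?mem_index_iota //.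
    by rewrite mem_head.
  by rewrite inE mem_head orbT.
pose g n : C := (q (j (delta R n)) -i* q ('i%C *: j (delta R n)))%C.
(* The weight is moved from the argument to the coefficients, so pairing with [al] is the functional
   with coefficients [g] composed with the multiplier. *)
pose al : Defs.sq R := fmul T (trunc N g).
have fal : fsupp al by apply: fsupp_fmul.
have qsum (x : Defs.sq R) M : (M <= N)%N -> q (\sum_(1 <= n < M) x n *: j (delta R n)) =
    complex.Re (\sum_(1 <= n < M) x n * g n).
  elim: M => [|M IH] MN; first by rewrite !big_geq // sublinear0.
  have [M0|M0] := leqP 1 M; last by rewrite !big_geq // sublinear0.
  rewrite !big_nat_recr //=; have [he hie] := hes M (introT andP (conj M0 MN)).
  rewrite sublinear_scalec //; [|exact: hq|exact: hq].
  by rewrite IH ?(ltnW MN) // -raddfD.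
have pal x : inX x -> complex.Re (pair al x) = q (j (fmul T x)).
  move=> /inXP fx; have sx := fmul_supp T (fsupp_at0 fx).
  rewrite (j_sum sx) qsum //; congr complex.Re.
  have [M hM] := fx.
  rewrite (pairE al (supp_inW (leq_maxl M N) hM)) (sum_supp (leq_maxr M N)); last first.
    by move=> n hn; rewrite /al /fmul (proj2 (trunc_supp N g)) // mulr0 mul0r.
  by apply: eq_big_nat => n hn; rewrite /al /fmul /trunc /cut hn mulrAC.
have le_pal x : inX x -> normc (pair al x) <= nv (j (fmul T x)).
  move=> hx; have /inXP fx := hx; have [u nu eu] := rotation_exists (pair al x).
  have f0 := fsupp0 R; have hu : inX (sq_lin u x (fun=> 0)) by apply/inXP; exact: fsupp_lin.
  have <- : complex.Re (pair al (sq_lin u x (fun=> 0))) = normc (pair al x).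
    by rewrite pair_linr // eu (@pairE _ _ (fun=> 0) 0) // big_geq // addr0.
  rewrite pal //; apply: (le_trans (lq _)); apply: (le_trans (l1 _)).
  have -> : fmul T (sq_lin u x (fun=> 0)) = sq_lin u (fmul T x) (fun=> 0).
    by apply/funext => n; rewrite /fmul /sq_lin !addr0 mulrCA.
  rewrite j_lin; [|by apply/inXP; apply: fsupp_fmul; exact: fsupp_at0|by apply/inXP].
  by rewrite j0 addr0 nvZ nu mul1r.
exists al; split => //.
  apply/MboundP; split=> // a b M sa sb; rewrite -(pair_dconv _ sa sb) mul1r.
  have fa : fsupp a by exists M.
  have fb : fsupp b by exists M.
  have fd := fsupp_dconv fa fb.
  apply: (le_trans (le_pal _ _)); first exact/inXP.
  by rewrite nv_j ?normX_fmul_dconv //; apply/inXP; apply: fsupp_fmul; exact: fsupp_at0.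
apply: (le_trans _ (Re_le_normc _)); apply: (le_trans _ (ler_norm _)).
rewrite pal // -(nv_j hc).
have := nvD (j c - j (fmul T c)) (j (fmul T c)); rewrite subrK => h2.
have h3 := sublinear_opp (j (fmul T c)) sq; have h4 := lq (- j (fmul T c)).
by lra.
Qed.

End Norming.

(** * Dual norms and the extension of L *)

Section Duals.
Variable R : realType.
Local Notation normc := (@ComplexField.Normc.normc R).
Local Notation C := R[i].
Local Notation sq := (sq R).
Implicit Types (al be : sq) (phi psi : fnl R) (Phi : bfnl R).

Lemma inf_bound_ge0 (P : R -> Prop) : (forall K, P K -> 0 <= K) -> 0 <= inf [set K | P K].
Proof.
move=> h; have [S0|/set0P S0] := eqVneq [set K | P K] set0; first by rewrite S0 inf0.
by apply: lb_le_inf => // K; exact: h.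
Qed.

Lemma inf_bound_le (P : R -> Prop) K : (forall K, P K -> 0 <= K) -> P K -> inf [set K | P K] <= K.
Proof. by move=> h PK; apply: ge_inf => //; exists 0 => L /h. Qed.

Lemma le_inf_bound (P : R -> Prop) (x y : R) : (exists K, P K) -> 0 <= y ->
  (forall K, P K -> x <= K * y) -> x <= inf [set K | P K] * y.
Proof.
move=> [K PK] y0 h; have [yp|yn] := ltrP 0 y; last first.
  have ye : y = 0 by apply/le_anti; rewrite yn y0.
  by have := h _ PK; rewrite ye !mulr0.
rewrite -ler_pdivrMr //; apply: lb_le_inf; first by exists K.
by move=> L PL; rewrite ler_pdivrMr // h.
Qed.

Lemma dualnorm_ge0 phi : 0 <= dualnorm phi.
Proof. by apply: inf_bound_ge0 => K []. Qed.

Lemma dualnorm_le phi K : dual_bound phi K -> dualnorm phi <= K.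
Proof. by apply: inf_bound_le => L []. Qed.

Lemma le_dualnorm phi al : in_dual phi -> inM0 al -> normc (phi al) <= dualnorm phi * opnorm al.
Proof.
move=> [_ hb] ha; apply: le_inf_bound => //; first exact: opnorm_ge0.
by move=> K [_]; apply.
Qed.

Lemma bidualnorm_ge0 Phi : 0 <= bidualnorm Phi.
Proof. by apply: inf_bound_ge0 => K []. Qed.

Lemma bidualnorm_le Phi K : bidual_bound Phi K -> bidualnorm Phi <= K.
Proof. by apply: inf_bound_le => L []. Qed.

Lemma le_bidualnorm Phi phi : in_bidual Phi -> in_dual phi ->
  normc (Phi phi) <= bidualnorm Phi * dualnorm phi.
Proof.
move=> [_ hb] ha; apply: le_inf_bound => //; first exact: dualnorm_ge0.
by move=> K [_]; apply.
Qed.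

Lemma in_dual_lin (k : C) phi psi : in_dual phi -> in_dual psi ->
  in_dual (fun al => k * phi al + psi al).
Proof.
move=> hphi hpsi; split.
  move=> l al be ha hb; rewrite (proj1 hphi) // (proj1 hpsi) //; ring.
exists (normc k * dualnorm phi + dualnorm psi); split.
  by rewrite addr_ge0 ?mulr_ge0 ?normc_ge0 ?dualnorm_ge0.
move=> al ha; rewrite (le_trans (ler_normcD _ _)) // normcM mulrDl lerD ?le_dualnorm //.
by rewrite -mulrA ler_wpM2l ?normc_ge0 // le_dualnorm.
Qed.

(** Functionals are encoded as functions on all sequences and may differ outside M_0; the difference
    then has dual norm 0, so a bounded [Phi] cannot see it. *)
Lemma bidual_ext Phi phi psi : in_bidual Phi -> in_dual phi -> in_dual psi ->
  (forall al, inM0 al -> phi al = psi al) -> Phi phi = Phi psi.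
Proof.
move=> hPhi hphi hpsi e.
have hd := in_dual_lin (-1) hphi hpsi.
have := le_bidualnorm hPhi hd; rewrite (proj1 hPhi) //.
have -> : dualnorm (fun al => -1 * phi al + psi al) = 0.
  apply/le_anti; rewrite dualnorm_ge0 andbT; apply: dualnorm_le; split=> // al ha.
  by rewrite e // mulN1r addNr normc0E mul0r.
rewrite mulr0 => h; apply/eqP; rewrite eq_sym -subr_eq0 addrC -mulN1r.
by apply/eqP/normc_eq0/le_anti; rewrite h normc_ge0.
Qed.

Lemma in_dual_pair c : inX c -> in_dual (fun al => pair al c).
Proof.
move=> hc; split=> [k al be _ _|]; first exact: pair_linl.
exists (normX c); split=> [|al [ha _]]; first exact: normX_ge0.
by rewrite mulrC; apply: normc_pair_le => //; exact: opnorm_bound.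
Qed.

Lemma in_bidual_iota al : inM0 al -> in_bidual (iotaM al).
Proof.
move=> ha; split=> [//|]; exists (opnorm al); split; first exact: opnorm_ge0.
by move=> phi hphi; rewrite mulrC; exact: le_dualnorm.
Qed.

Lemma in_bidual_lin (k : C) Phi Psi : in_bidual Phi -> in_bidual Psi ->
  in_bidual (fun phi => k * Phi phi + Psi phi).
Proof.
move=> hPhi hPsi; split.
  move=> l phi psi ha hb; rewrite (proj1 hPhi) // (proj1 hPsi) //; ring.
exists (normc k * bidualnorm Phi + bidualnorm Psi); split.
  by rewrite addr_ge0 ?mulr_ge0 ?normc_ge0 ?bidualnorm_ge0.
move=> phi ha; rewrite (le_trans (ler_normcD _ _)) // normcM mulrDl lerD ?le_bidualnorm //.
by rewrite -mulrA ler_wpM2l ?normc_ge0 // le_bidualnorm.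
Qed.

End Duals.

Section Extension.
Variables (R : realType) (V : normedModType R[i]) (j : sq R -> V).
Hypothesis j_lin : forall (k : R[i]) (c d : sq R), inX c -> inX d ->
  j (sq_lin k c d) = k *: j c + j d.
Hypothesis j_isom : forall c : sq R, inX c -> `|j c| = ((normX c)%:C)%C.
Hypothesis j_dense : forall (v : V) (eps : R), 0 < eps ->
  exists2 c, inX c & `|v - j c| < (eps%:C)%C.
Local Notation normc := (@ComplexField.Normc.normc R).
Local Notation C := R[i].
Local Notation sq := (sq R).
Implicit Types (a b c d al be : sq) (N T : nat) (u v : V).

Lemma j_near v (e : R) : 0 < e -> exists2 c, inX c & nv (v - j c) < e.
Proof.
by move=> e0; have [c hc h] := j_dense v e0; exists c => //; rewrite -ltcR -nvE.
Qed.

Lemma pair_dist al c d : inM al -> inX c -> inX d ->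
  normc (pair al c - pair al d) <= opnorm al * nv (j c - j d).
Proof.
move=> ha hc hd.
have -> : j c - j d = j (sq_lin (-1) d c) by rewrite j_lin // scaleN1r addrC.
have -> : pair al c - pair al d = pair al (sq_lin (-1) d c).
  by move/inXP: hc => hc; move/inXP: hd => hd; rewrite pair_linr // mulN1r addrC.
have h := inX_lin (-1) hd hc.
by rewrite (nv_j j_isom h); apply: normc_pair_le => //; exact: opnorm_bound.
Qed.

Lemma inX0 : inX (fun=> 0 : C).
Proof. by apply/inXP; exact: fsupp0. Qed.

(** McShane extension: the infimum of g(c) + K ||v - j c|| over c in X. *)
Lemma lipschitz_extension (g : sq -> R) (K : R) v : 0 <= K ->
  (forall c d, inX c -> inX d -> g c - g d <= K * nv (j c - j d)) ->
  exists r, forall c, inX c -> `|r - g c| <= K * nv (v - j c).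
Proof.
move=> K0 h; pose S := [set g c + K * nv (v - j c) | c in @inX R].
have lb d : inX d -> lbound S (g d - K * nv (v - j d)).
  move=> hd _ [c hc <-]; have h1 := h d c hd hc.
  have h2 : K * nv (j d - j c) <= K * nv (v - j d) + K * nv (v - j c).
    rewrite -mulrDr ler_wpM2l // (le_trans (nv_distD v _ _)) //.
    by rewrite (nv_distC (j d)).
  by lra.
have S0 : S !=set0 by exists (g (fun=> 0) + K * nv (v - j (fun=> 0))), (fun=> 0) => //; exact: inX0.
exists (inf S) => c hc; rewrite ler_distl; apply/andP; split.
  by apply: lb_le_inf => //; exact: lb.
apply: ge_inf; last by exists c.
by exists (g c - K * nv (v - j c)); exact: lb.
Qed.

(** The factor 2 comes from extending real and imaginary parts separately. By density the condition
    determines [z]. *)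
Definition Lspec v al (z : C) := forall c, inX c ->
  normc (z - pair al c) <= 2 * opnorm al * nv (v - j c).

(** The default 0 can occur only for [al] outside M, by [LextP]. *)
Definition Lext v : fnl R := fun al => xget 0 [set z | Lspec v al z].

Lemma LextP v al : inM al -> Lspec v al (Lext v al).
Proof.
move=> ha; apply: (@xgetPex _ 0 [set z | Lspec v al z]).
have K0 := opnorm_ge0 al.
have [|r hr] := @lipschitz_extension (fun c => complex.Re (pair al c)) (opnorm al) v K0.
  move=> c d hc hd; rewrite -raddfB; apply: (le_trans _ (pair_dist ha hc hd)).
  by apply: (le_trans _ (Re_le_normc _)); exact: ler_norm.
have [|s hs] := @lipschitz_extension (fun c => complex.Im (pair al c)) (opnorm al) v K0.
  move=> c d hc hd; rewrite -raddfB; apply: (le_trans _ (pair_dist ha hc hd)).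
  by apply: (le_trans _ (Im_le_normc _)); exact: ler_norm.
exists (Complex r s) => c hc; apply: (le_trans (normc_le_ReIm _)).
have := hr c hc; have := hs c hc; case: (pair al c) => x y /= h1 h2.
by lra.
Qed.

Lemma Lext_j c al : inX c -> inM al -> Lext (j c) al = pair al c.
Proof.
move=> hc ha; have := LextP (j c) ha hc; rewrite subrr nv0 mulr0 => h.
apply/eqP; rewrite -subr_eq0; apply/eqP/normc_eq0/le_anti.
by rewrite h normc_ge0.
Qed.

Lemma Lext_lin (k : C) u v al : inM al -> Lext (k *: u + v) al = k * Lext u al + Lext v al.
Proof.
move=> ha; apply/eqP; rewrite -subr_eq0; apply/eqP.
have K0 := opnorm_ge0 al; have k0 := normc_ge0 k; set K := opnorm al in K0.
apply: (@normc_le_eps _ (4 * K * (normc k + 1))); first by rewrite !mulr_ge0 // addr_ge0.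
move=> e e0; have [c hc h1] := j_near u e0; have [d hd h2] := j_near v e0.
have hl := inX_lin k hc hd.
have p1 := LextP (k *: u + v) ha hl; have p2 := LextP u ha hc; have p3 := LextP v ha hd.
rewrite -/K in p1 p2 p3.
have n1 : nv (k *: u + v - j (sq_lin k c d)) <= normc k * nv (u - j c) + nv (v - j d).
  rewrite j_lin // opprD addrACA -scalerBr (le_trans (nvD _ _)) // nvZ //.
have -> : Lext (k *: u + v) al - (k * Lext u al + Lext v al) =
  (Lext (k *: u + v) al - pair al (sq_lin k c d)) - (k * (Lext u al - pair al c) + (Lext v al - pair al d)).
  by move/inXP: hc => hc; move/inXP: hd => hd; rewrite pair_linr //; ring.
apply: (le_trans (ler_normcB _ _)); apply: (le_trans (lerD p1 (ler_normcD _ _))).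
rewrite normcM; have := ler_wpM2l k0 p2.
have q1 : K * nv (k *: u + v - j (sq_lin k c d)) <= K * (normc k * e + e).
  apply: ler_wpM2l => //; apply: (le_trans n1); rewrite lerD ?(ltW h2) //.
  by rewrite ler_wpM2l // ltW.
have q2 : K * nv (u - j c) <= K * e by rewrite ler_wpM2l // ltW.
have q3 : K * nv (v - j d) <= K * e by rewrite ler_wpM2l // ltW.
have := ler_wpM2l k0 q2.
by lra.
Qed.

Lemma Lext_linl v (k : C) al be : inM al -> inM be ->
  Lext v (sq_lin k al be) = k * Lext v al + Lext v be.
Proof.
move=> ha hb; have hl := inM_lin k ha hb; apply/eqP; rewrite -subr_eq0; apply/eqP.
have K0 := opnorm_ge0 al; have k0 := normc_ge0 k; have L0 := opnorm_ge0 be.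
have M0 := opnorm_ge0 (sq_lin k al be).
apply: (@normc_le_eps _ (2 * opnorm (sq_lin k al be) + (normc k * (2 * opnorm al) + 2 * opnorm be))).
  by rewrite !addr_ge0 ?mulr_ge0.
move=> e e0; have [c hc h1] := j_near v e0.
have p1 := LextP v hl hc; have p2 := LextP v ha hc; have p3 := LextP v hb hc.
have -> : Lext v (sq_lin k al be) - (k * Lext v al + Lext v be) =
  (Lext v (sq_lin k al be) - pair (sq_lin k al be) c) - (k * (Lext v al - pair al c) + (Lext v be - pair be c)).
  by rewrite pair_linl; ring.
rewrite mulrDl; apply: (le_trans (ler_normcB _ _)); apply: lerD.
  by apply: (le_trans p1); rewrite ler_wpM2l ?mulr_ge0 // ltW.
rewrite mulrDl; apply: (le_trans (ler_normcD _ _)); apply: lerD.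
  rewrite normcM -mulrA ler_wpM2l //; apply: (le_trans p2).
  by rewrite ler_wpM2l ?mulr_ge0 // ltW.
by apply: (le_trans p3); rewrite ler_wpM2l ?mulr_ge0 // ltW.
Qed.

Lemma Lext_bound v al : inM al -> normc (Lext v al) <= nv v * opnorm al.
Proof.
move=> ha; apply/ler_addgt0Pl => e e0; have K0 := opnorm_ge0 al.
(* The 3 is 2 from [Lspec] plus 1 from comparing the norms of [v] and [j c]. *)
set K := opnorm al in K0 *; have K1 : 0 < 3 * K + 1 by lra.
have [c hc h1] := j_near v (divr_gt0 e0 K1).
have h2 := LextP v ha hc; have h3 := normc_pair_le (opnorm_bound ha) hc.
rewrite -/K in h2 h3; rewrite -(nv_j j_isom hc) in h3.
have h4 := ler_normcD (Lext v al - pair al c) (pair al c); rewrite subrK in h4.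
have h5 : nv (j c) <= nv v + nv (v - j c).
  by have := nv_distD v (j c) 0; rewrite !subr0 (nv_distC (j c)) addrC.
have h6 := ler_wpM2l K0 h5; have h7 := ler_wpM2l K0 (ltW h1).
have h8 : 3 * K * (e / (3 * K + 1)) <= e.
  by rewrite mulrA ler_pdivrMr // mulrC ler_pM2l //; lra.
by lra.
Qed.

Lemma Lext_dual_bound v : dual_bound (Lext v) (nv v).
Proof. by split=> [|al [ha _]]; [exact: nv_ge0|exact: Lext_bound]. Qed.

Lemma Lext_in_dual v : in_dual (Lext v).
Proof.
split=> [k al be [ha _] [hb _]|]; first exact: Lext_linl.
by exists (nv v); exact: Lext_dual_bound.
Qed.

(** For the lower bound, the norming functionals are finitely supported and therefore lie in M_0,
    not merely in M. *)
Lemma Lext_dualnorm v : dualnorm (Lext v) = nv v.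
Proof.
apply/le_anti/andP; split; first exact/dualnorm_le/Lext_dual_bound.
(* Four quarters: two from [Lspec], one from the norming functional, one from replacing [v] by
   [j c]. *)
apply/ler_addgt0Pl => e e0; have e4 : 0 < e / 4 by rewrite divr_gt0.
have [c hc h1] := j_near v e4.
have [al [fal bal hal]] := norming_functional j_lin j_isom hc e4.
have ha := inM0_fsupp fal; have oa := opnorm_le bal.
have h2 := le_dualnorm (Lext_in_dual v) ha; have h3 := LextP v (proj1 ha) hc.
have h4 := ler_normcD (pair al c - Lext v al) (Lext v al); rewrite subrK normc_distC in h4.
have h5 : dualnorm (Lext v) * opnorm al <= dualnorm (Lext v).
  by rewrite -[leRHS]mulr1 ler_wpM2l ?dualnorm_ge0.
have h6 : opnorm al * nv (v - j c) <= 1 * (e / 4).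
  by rewrite ler_pM ?opnorm_ge0 ?nv_ge0 // ltW.
have h7 : nv v <= nv (j c) + nv (v - j c).
  by have := nv_distD (j c) v 0; rewrite !subr0 addrC.
by rewrite (nv_j j_isom hc) in h7; lra.
Qed.

End Extension.

(** * Surjectivity *)

Section Completeness.
Variables (R : realType) (V : completeNormedModType R[i]).

Lemma cauchy_seq_cvg (x : nat -> V) :
  (forall e : R, 0 < e -> exists T0, forall S T, (T0 <= S)%N -> (T0 <= T)%N -> nv (x S - x T) <= e) ->
  exists v, forall e : R, 0 < e -> exists T0, forall T, (T0 <= T)%N -> nv (v - x T) <= e.
Proof.
move=> h; have hc : cvg (x @ \oo).
  apply/cauchy_cvgP/cauchy_ballP => e e0.
  have er : e = ((complex.Re e)%:C)%C by rewrite RRe_real // gtr0_real.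
  have e1 : 0 < complex.Re e by rewrite -ltcR -er.
  have e2 : 0 < complex.Re e / 2 by rewrite divr_gt0.
  have [T0 hT] := h _ e2.
  exists ([set y | exists2 T, (T0 <= T)%N & y = x T], [set y | exists2 T, (T0 <= T)%N & y = x T]).
    by split; exists T0 => // n hn; exists n.
  move=> [y z] /= [[S hS ->] [T hT' ->]]; rewrite -ball_normE /ball_ /= nvE er ltcR.
  by rewrite (le_lt_trans (hT _ _ hS hT')) // ltr_pdivrMr // ltr_pMr // ltr1n.
exists (lim (x @ \oo)) => e e0.
have ec : 0 < (e%:C)%C by rewrite ltcR.
have /cvgrPdist_le/(_ _ ec) [T0 _ hT] := hc.
by exists T0 => T hTT; have := hT T hTT; rewrite /= nvE lecR.
Qed.

End Completeness.

Section Onto.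
Variables (R : realType).
Local Notation normc := (@ComplexField.Normc.normc R).
Local Notation C := R[i].
Local Notation sq := (sq R).
Implicit Types (a b c d al be ga : sq) (N T : nat) (phi : fnl R).

Lemma inM0_fmul T al : inM al -> inM0 (fmul T al).
Proof. by move=> ha; apply: inM0_fsupp; apply: fsupp_fmul; case: ha. Qed.

(** The remainder of the truncation, written with [sq_lin] so that linearity of functionals applies
    directly. *)
Definition fdiff T al : sq := sq_lin (-1) (fmul T al) al.

Lemma kbound_fdiff T al K : kbound (hk al) K -> kbound (hk (fdiff T al)) (2 * K).
Proof.
move=> h; have -> : 2 * K = normc (-1) * K + K by rewrite normcN normc1E; ring.
exact: kboundD (kboundZ (-1) (kbound_fmul T h)) h.
Qed.

Lemma fdiffE T al n : fdiff T al n = ((1 - fejer R T n)%:C)%C * al n.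
Proof. by rewrite /fdiff /sq_lin /fmul rmorphB rmorph1; ring. Qed.

(** Products of indices below [N] stay below N^2, where the weights are uniformly close to 1; hence
    [T0] does not depend on [al]. *)
Lemma fdiff_small N (e : R) : 0 < e -> exists T0, forall T, (T0 <= T)%N ->
  forall al K, kbound (hk al) K -> forall n m, (0 < n < N)%N -> (0 < m < N)%N ->
  normc (hk (fdiff T al) n m) <= e * K.
Proof.
move=> e0; have [T0 hT] := fejer_cvg (N * N) e0.
exists T0 => T h al K hK n m /andP[n0 nN] /andP[m0 mN].
rewrite /hk fdiffE normcM normc_real ger0_norm ?subr_ge0 ?fejer_le1 //.
rewrite ler_pM ?normc_ge0 ?subr_ge0 ?fejer_le1 //; first by rewrite hT // ltn_mul.
exact: (kbound_entry hK).
Qed.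

Lemma in_dual0 phi : in_dual phi -> phi (fun=> 0) = 0.
Proof.
move=> hphi; have h0 : inM0 (fun=> 0 : C) by apply: inM0_fsupp; exact: fsupp0.
have := proj1 hphi (-1) _ _ h0 h0; rewrite mulN1r addNr.
suff -> : sq_lin (-1) (fun=> 0) (fun=> 0) = (fun=> 0) :> sq by [].
by apply/funext => n; rewrite /sq_lin mulr0 addr0.
Qed.

(* Gliding hump: K humps of size one in M_0 can be stacked into an operator of norm O(sqrt K),
   which a bounded functional cannot see as having size K. *)
Lemma fejer_uniform phi (e : R) : in_dual phi -> 0 < e -> exists T0, forall T, (T0 <= T)%N ->
  forall al, inM0 al -> kbound (hk al) 1 -> normc (phi (fdiff T al)) <= e.
Proof.
move=> hphi e0; apply: contrapT => nh.
have bad T0 : exists T al, [/\ (T0 <= T)%N, inM0 al, kbound (hk al) 1 & e < normc (phi (fdiff T al))].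
  apply: contrapT => nT; apply: nh; exists T0 => T hT al ha ba.
  by rewrite leNgt; apply/negP => lt; apply: nT; exists T, al.
(* A hump has norm at most 2, so each hook step adds 13 * 2^2 = 52 to the squared norm. *)
have humps k : exists ga, [/\ inM0 ga, kbound (hk ga) (Num.sqrt (52%:R * k%:R)) &
    k%:R * e <= complex.Re (phi ga)].
  elim: k => [|k [ga [hga bga rga]]].
    exists (fun=> 0); have h0 : inM0 (fun=> 0 : C) by apply: inM0_fsupp; exact: fsupp0.
    split => //.
      move=> a b N; rewrite mulr0 sqrtr0 !mul0r /kf big1 ?normc0E // => n _.
      by rewrite big1 // => m _; rewrite mulr0.
    by rewrite mul0r in_dual0.
  have /inM0P [_ tga] := hga.
  have [N0 [d [_ d0 hook]]] := hook_step 0 bga tga (ltr0Sn R 1).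
  have [T0 hT0] := fdiff_small N0 d0.
  have [T [al [hT ha ba lt]]] := bad T0.
  (* Aligning the phases lets the values of [phi] on the humps add up. *)
  have [u nu eu] := rotation_exists (phi (fdiff T al)).
  have hfd : inM0 (fdiff T al) by apply: inM0_lin => //; apply: inM0_fmul; case: ha.
  exists (sq_lin u (fdiff T al) ga); split; first exact: inM0_lin.
    have bB : kbound (fun n m => u * hk (fdiff T al) n m) 2%:R.
      by have := kboundZ u (kbound_fdiff T ba); rewrite nu mul1r mulr1.
    have := hook _ bB.
    have -> : Num.sqrt (52%:R * k%:R) ^+ 2 + 13%:R * 2%:R ^+ 2 = 52%:R * k.+1%:R :> R.
      by rewrite sqr_sqrtr ?mulr_ge0 // -[k.+1%:R]natr1; ring.
    move=> h; apply: (kbound_eq _ (h _)) => [n m _ _|n m hn hm]; first by rewrite addrC.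
    by rewrite normcM nu mul1r -[d]mulr1; exact: hT0.
  rewrite (proj1 hphi) // eu raddfD /= -natr1 mulrDl mul1r addrC lerD //.
  exact: ltW.
have D0 := dualnorm_ge0 phi; set D := dualnorm phi in D0.
(* For k > 52 D^2 / e^2 the bound k e <= D sqrt(52 k) is violated. *)
pose k := (Num.bound (52%:R * D ^+ 2 / e ^+ 2)).+1.
have [ga [hga bga rga]] := humps k.
have h1 : k%:R * e <= D * Num.sqrt (52%:R * k%:R).
  apply: (le_trans rga); apply: (le_trans (ler_norm _)); apply: (le_trans (Re_le_normc _)).
  apply: (le_trans (le_dualnorm hphi hga)); rewrite -/D ler_wpM2l //; exact: opnorm_le.
have k0 : 0 < k%:R :> R by rewrite ltr0n.
have h2 : (k%:R * e) ^+ 2 <= (D * Num.sqrt (52%:R * k%:R)) ^+ 2.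
  by rewrite ler_pXn2r ?nnegrE ?mulr_ge0 ?sqrtr_ge0 // ltW.
move: h2; rewrite !exprMn sqr_sqrtr ?mulr_ge0 //.
have -> : D ^+ 2 * (52%:R * k%:R) = k%:R * (52%:R * D ^+ 2) by ring.
have -> : k%:R ^+ 2 * e ^+ 2 = k%:R * (k%:R * e ^+ 2) :> R by ring.
rewrite ler_pM2l // -ler_pdivlMr ?exprn_gt0 //; apply/negP; rewrite -ltNge.
apply: (lt_le_trans (archi_boundP _)); first by rewrite divr_ge0 ?sqr_ge0 // mulr_ge0 // sqr_ge0.
by rewrite ler_nat.
Qed.

Lemma fejer_uniform_scaled phi (e : R) : in_dual phi -> 0 < e -> exists T0, forall T, (T0 <= T)%N ->
  forall al K, inM0 al -> 0 < K -> kbound (hk al) K -> normc (phi (fdiff T al)) <= e * K.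
Proof.
move=> hphi e0; have [T0 hT] := fejer_uniform hphi e0; exists T0 => T h al K ha K0 bK.
have h0 : inM0 (fun=> 0 : C) by apply: inM0_fsupp; exact: fsupp0.
pose be := sq_lin ((K^-1)%:C)%C al (fun=> 0).
have hb : inM0 be by exact: inM0_lin.
have nK : normc ((K^-1)%:C)%C = K^-1 by rewrite normc_real ger0_norm // invr_ge0 ltW.
have bb : kbound (hk be) 1.
  have := kboundZ ((K^-1)%:C)%C bK; rewrite nK mulVf ?gt_eqF // => hh.
  by apply: (kbound_eq _ hh) => n m _ _; rewrite /hk /be /sq_lin addr0.
have hfd : inM0 (fdiff T al) by apply: inM0_lin => //; apply: inM0_fmul; case: ha.
have := hT T h be hb bb.
have -> : fdiff T be = sq_lin ((K^-1)%:C)%C (fdiff T al) (fun=> 0).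
  by apply/funext => n; rewrite fdiffE /sq_lin fdiffE /be /sq_lin !addr0; ring.
rewrite (proj1 hphi) // in_dual0 // addr0 normcM nK mulrC ler_pdivrMr //.
Qed.

(** The element of X that represents [phi] composed with the multiplier. *)
Definition fcoef phi T : sq := fmul T (fun n => if n == 0%N then 0 else phi (delta R n)).

Lemma fsupp_fcoef phi T : fsupp (fcoef phi T).
Proof. by apply: fsupp_fmul. Qed.

Lemma pair_fcoef phi T al : in_dual phi -> al 0%N = 0 -> pair al (fcoef phi T) = phi (fmul T al).
Proof.
move=> hphi a0; have lin (k : C) c d : fsupp c -> fsupp d ->
    phi (sq_lin k c d) = k *: (phi c : C^o) + phi d.
  by move=> hc hd; rewrite (proj1 hphi) //; exact: inM0_fsupp.
rewrite [RHS](fsupp_linear_sum lin (fmul_supp T a0)).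
rewrite (pairE al (fmul_supp T (erefl _))); apply: eq_big_nat => n /andP[n0 _].
by rewrite /fcoef /fmul gtn_eqF // mulrCA mulrA.
Qed.

End Onto.

Section OntoExtension.
Variables (R : realType) (V : completeNormedModType R[i]) (j : sq R -> V).
Hypothesis j_lin : forall (k : R[i]) (c d : sq R), inX c -> inX d ->
  j (sq_lin k c d) = k *: j c + j d.
Hypothesis j_isom : forall c : sq R, inX c -> `|j c| = ((normX c)%:C)%C.
Local Notation normc := (@ComplexField.Normc.normc R).
Local Notation C := R[i].
Local Notation sq := (sq R).

(** The elements [fcoef phi T] are Cauchy: norming functionals reduce their differences to the
    uniform estimate for [fdiff]. Their limit represents [phi]. *)
Lemma Lext_onto phi : in_dual phi ->
  exists v, forall al, inM0 al -> Lext j v al = phi al.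
Proof.
move=> hphi.
have hX T : inX (fcoef phi T) by apply/inXP; exact: fsupp_fcoef.
have phiB T al : inM0 al -> phi (fdiff T al) = phi al - phi (fmul T al).
  by move=> ha; rewrite (proj1 hphi) ?mulN1r 1?addrC //; apply: inM0_fmul; case: ha.
have [e e0|v hv] := @cauchy_seq_cvg R V (fun T => j (fcoef phi T)).
  (* One third for each of the two truncations and one for the norming functional. *)
  have e3 : 0 < e / 3 by rewrite divr_gt0.
  have [T0 hT0] := fejer_uniform_scaled hphi e3; exists T0 => S T hS hT.
  have -> : j (fcoef phi S) - j (fcoef phi T) = j (sq_lin (-1) (fcoef phi T) (fcoef phi S)).
    by rewrite j_lin // scaleN1r addrC.
  have hl := inX_lin (-1) (hX T) (hX S); rewrite (nv_j j_isom hl).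
  have [al [fal bal hal]] := norming_functional j_lin j_isom hl e3.
  have ha := inM0_fsupp fal; have a0 := fsupp_at0 fal.
  have e1 : pair al (sq_lin (-1) (fcoef phi T) (fcoef phi S)) = phi (fdiff T al) - phi (fdiff S al).
    by rewrite pair_linr ?pair_fcoef ?phiB //; [ring|exact: fsupp_fcoef|exact: fsupp_fcoef].
  have h1 := hT0 T hT al 1 ha ltr01 bal; have h2 := hT0 S hS al 1 ha ltr01 bal.
  by have := ler_normcB (phi (fdiff T al)) (phi (fdiff S al)); rewrite -e1; lra.
exists v => al ha; have a0 := proj1 (proj1 ha); apply/eqP; rewrite -subr_eq0; apply/eqP.
have K0 := opnorm_ge0 al; set K := opnorm al in K0.
apply: (@normc_le_eps _ (2 * K + (K + 1))); first by lra.
move=> e e0; have [T1 h1] := hv e e0; have [T2 h2] := fejer_uniform_scaled hphi e0.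
(* [K + 1] replaces [K] because the scaled estimate asks for a positive bound. *)
pose T := maxn T1 T2; have K1 : 0 < K + 1 by lra.
have {}h1 := h1 T (leq_maxl _ _).
have bK : kbound (hk al) (K + 1) by apply: kboundW (opnorm_bound (proj1 ha)); rewrite -/K; lra.
have {}h2 := h2 T (leq_maxr _ _) al _ ha K1 bK.
have h3 := LextP j_lin j_isom v (proj1 ha) (hX T).
rewrite pair_fcoef // -/K in h3.
rewrite phiB // normc_distC in h2.
apply: (le_trans (ler_normc_distD (phi (fmul T al)) _ _)).
have h4 : 2 * K * nv (v - j (fcoef phi T)) <= 2 * K * e by rewrite ler_wpM2l // mulr_ge0.
by lra.
Qed.

End OntoExtension.

(** * Isometries of the bidual *)

Section AveragedHooks.
Variable R : realType.
Local Notation normc := (@ComplexField.Normc.normc R).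
Local Notation C := R[i].
Local Notation sq := (sq R).
Implicit Types (a b c d al be : sq) (N T : nat) (G H : kernel R).

Lemma kboundB G H (K L : R) : kbound G K -> kbound H L -> kbound (fun n m => G n m - H n m) (K + L).
Proof.
move=> hG hH; have := kboundZ (-1) hH; rewrite normcN normc1E mul1r => hN.
by apply: (kbound_eq _ (kboundD hG hN)) => n m _ _; rewrite mulN1r.
Qed.

(** Complementary diagonal blocks act on orthogonal subspaces, so the norms do not add. *)
Lemma kbound_diag G H (K : R) (P : pred nat) : kbound G K -> kbound H K ->
  kbound (fun n m => (if P n && P m then G n m else 0) +
                     (if predC P n && predC P m then H n m else 0)) K.
Proof.
move=> hG hH a b N; rewrite kfD.
have kcut F (Q : pred nat) :
    kf (fun n m => if Q n && Q m then F n m else 0) a b N = kf F (cut Q a) (cut Q b) N.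
  by apply: eq_kf => n m _ _; rewrite /cut; case: (Q n); case: (Q m); rewrite /= ?(mulr0, mul0r).
rewrite !kcut; apply: (le_trans (ler_normcD _ _)); apply: (le_trans (lerD (hG _ _ _) (hH _ _ _))).
rewrite -!mulrA -mulrDr ler_wpM2l ?(kbound_ge0 hG) //.
apply: (le_trans (CauchySchwarz2 _ _ _ _)).
by rewrite -!sqr_nl_cut !sqrtr_sqr !ger0_norm ?nl_ge0.
Qed.

(* The cross terms of al - fmul T al are only small on average: averaging k well separated
   truncations makes them O(1/sqrt k). *)
Lemma averaged_hooks al (rho : R) n0 (zeta : C) (k : nat) (e : R) :
  kbound (hk al) rho -> al 0%N = 0 -> 0 < rho -> (0 < n0)%N -> normc zeta = 1 -> 0 < e ->
  exists z G, [/\ fsupp z, ktail G, kbound G (Num.sqrt (13%:R * (3%:R * rho) ^+ 2 * k%:R)),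
    normc (z n0 - k%:R * al n0) <= k%:R * e &
    kbound (fun n m => k%:R * ((rho%:C)%C * zeta * delta R n0 (n * m)%N + al (n * m)%N)
                       - z (n * m)%N - G n m) (k%:R * rho)].
Proof.
move=> bal al0 rho0 n00 nz e0.
have A0 : 0 < 3%:R * rho by lra.
elim: k => [|k [z [G [fz tG bG nzk bD]]]].
  exists (fun=> 0), (fun _ _ => 0); split.
  - exact: fsupp0.
  - by apply: (ktail_fsupp (N0 := 0)).
  - move=> a b N; rewrite mulr0 sqrtr0 !mul0r /kf big1 ?normc0E // => n _.
    by rewrite big1 // => m _; rewrite mulr0.
  - by rewrite !mul0r subr0 normc0E.
  move=> a b N; rewrite !mul0r /kf big1 ?normc0E // => n _.
  by rewrite big1 // => m _; rewrite mul0r !subr0 mulr0.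
have [N0 [d [n0N d0 hook]]] := hook_step n0.+1 bG tG A0.
(* One [T] serves both the hook, which needs entries at most [d], and the coefficient at [n0], which
   needs error [e]. *)
have dr : 0 < Num.min d e / rho by rewrite divr_gt0 // lt_min d0 e0.
have [T hT] := fdiff_small N0 dr; have {}hT := hT T (leqnn T) al rho bal.
rewrite mulfVK ?gt_eqF // in hT.
pose P : pred nat := gtn N0.
(* The difference of [al] and its truncation without the block of indices from [N0] on: small where
   both indices are below [N0], and with small tails because only finitely many rows and columns and
   a truncation remain. *)
pose g : kernel R := fun n m => (hk al n m - (if predC P n && predC P m then hk al n m else 0))
                                - hk (fmul T al) n m.
have ge n m : P n && P m -> g n m = hk (fdiff T al) n m.
  move=> /andP[h1 h2]; rewrite /g ifF ?subr0 /= ?h1 //.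
  by rewrite /hk /fdiff /sq_lin mulN1r addrC.
have bg : kbound g (3%:R * rho).
  (* One [rho] each for [al], the removed block and the truncation. *)
  have -> : 3%:R * rho = rho + rho + rho by ring.
  exact: kboundB (kboundB bal (kbound_cut _ _ bal)) (kbound_fmul T bal).
have hal : inM al by exact: kbound_inM bal.
have tg : ktail g.
  have t1 := ktail_rows N0 bal.
  have t2 := ktail_cols N0 (kbound_cut (predC P) xpredT bal).
  have /inM0P [_ t3] := inM0_fmul T hal.
  apply: (ktail_eq _ (ktailD (ktailD t1 t2) (ktailZ (-1) t3))) => n m _ _.
  rewrite /g /P /= mulN1r; congr (_ - _).
  by case: (n < N0)%N; case: (m < N0)%N; rewrite /= ?subr0 ?addr0 ?add0r ?subrr.
have small n m : (0 < n < N0)%N -> (0 < m < N0)%N -> normc (g n m) <= d.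
  move=> hn hm; rewrite ge; last by rewrite /P /=; case/andP: hn => _ ->; case/andP: hm => _ ->.
  by apply: (le_trans (hT n m hn hm)); rewrite ge_min lexx.
exists (sq_lin 1 (fmul T al) z), (fun n m => G n m + g n m); split.
- by apply: fsupp_lin => //; exact: fsupp_fmul.
- exact: ktailD.
- have := hook g bg small; rewrite sqr_sqrtr; last by rewrite !mulr_ge0 ?(ltW rho0).
  have -> : 13%:R * (3%:R * rho) ^+ 2 * k%:R + 13%:R * (3%:R * rho) ^+ 2 =
    13%:R * (3%:R * rho) ^+ 2 * k.+1%:R by rewrite -[k.+1%:R]natr1; ring.
  by [].
- have h1 : (0 < n0 < N0)%N by rewrite n00.
  have h2 : (0 < 1 < N0)%N by rewrite (leq_ltn_trans n00 n0N).
  have := hT n0 1%N h1 h2; rewrite /hk muln1 => h3.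
  have -> : sq_lin 1 (fmul T al) z n0 - k.+1%:R * al n0 =
      (z n0 - k%:R * al n0) - fdiff T al n0.
    by rewrite /fdiff /sq_lin -natr1; ring.
  apply: (le_trans (ler_normcB _ _)); rewrite -natr1 mulrDl mul1r lerD //.
  by apply: (le_trans h3); rewrite ge_min lexx orbT.
have bx : kbound (fun n m => (rho%:C)%C * zeta * hk (delta R n0) n m) rho.
  by have := kboundZ ((rho%:C)%C * zeta) (kbound_delta n0);
     rewrite normcM normc_real nz ger0_norm ?(ltW rho0) // !mulr1.
(* The new summand is block diagonal: the multiple of [delta R n0] lies below [N0], as n m = n0
   bounds both factors, and the rest of [al] lies beyond. Its norm is therefore [rho] and not 2
   rho. *)
have := kboundD bD (kbound_diag P bx bal).
have -> : k%:R * rho + rho = k.+1%:R * rho by rewrite -natr1 mulrDl mul1r.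
move=> h; apply: (kbound_eq _ h) => n m hn hm.
have -> : (if P n && P m then (rho%:C)%C * zeta * hk (delta R n0) n m else 0) =
    (rho%:C)%C * zeta * delta R n0 (n * m)%N.
  case: ifPn => // /negP hP; rewrite /delta; case: eqP => [e1|_]; last by rewrite mulr0.
  case: hP; rewrite /P /=; apply/andP; split; apply: leq_trans n0N; rewrite ltnS -e1.
    exact: leq_pmulr.
  exact: leq_pmull.
rewrite /g /hk /sq_lin -natr1; set I := if _ then _ else _; ring.
Qed.

(** Divides the previous sums by k > A / e^2, so that the accumulated hooks, of norm sqrt(A k),
    contribute at most [e]. *)
Lemma averaged_truncation al (rho : R) n0 (zeta : C) (e : R) :
  kbound (hk al) rho -> al 0%N = 0 -> 0 < rho -> (0 < n0)%N -> normc zeta = 1 -> 0 < e ->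
  exists z, [/\ fsupp z, normc (z n0 - al n0) <= e &
    kbound (hk (fun n => (rho%:C)%C * zeta * delta R n0 n + al n - z n)) (rho + e)].
Proof.
move=> bal al0 rho0 n00 nz e0.
pose A := 13%:R * (3%:R * rho) ^+ 2.
have A0 : 0 <= A by rewrite mulr_ge0 ?sqr_ge0.
pose k := (Num.bound (A / e ^+ 2)).+1.
have k0 : 0 < k%:R :> R by rewrite ltr0n.
have Ak : A / e ^+ 2 < k%:R.
  by rewrite (lt_le_trans (archi_boundP _)) ?divr_ge0 ?sqr_ge0 // ler_nat.
clearbody k.
have [z [G [fz _ bG nzk bD]]] := averaged_hooks k bal al0 rho0 n00 nz e0.
have sk : Num.sqrt (A * k%:R) <= k%:R * e.
  rewrite -[leRHS]ger0_norm ?mulr_ge0 ?(ltW e0) // -sqrtr_sqr ler_sqrt ?sqr_ge0 //.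
  rewrite exprMn [k%:R ^+ 2]expr2 -mulrA mulrC ler_pM2l //.
  by rewrite -ler_pdivrMr ?exprn_gt0 // ltW.
have kC : k%:R != 0 :> C by rewrite pnatr_eq0 -lt0n -(ltr0n R).
have nk : normc (k%:R^-1 : C) = k%:R^-1.
  have -> : (k%:R^-1 : C) = ((k%:R^-1)%:C)%C by rewrite fmorphV rmorph_nat.
  by rewrite normc_real ger0_norm // invr_ge0.
exists (sq_lin k%:R^-1 z (fun=> 0)); split.
- by apply: fsupp_lin => //; exact: fsupp0.
- have -> : sq_lin k%:R^-1 z (fun=> 0) n0 - al n0 = k%:R^-1 * (z n0 - k%:R * al n0).
    by rewrite /sq_lin addr0 mulrBr mulKf.
  by rewrite normcM nk mulrC ler_pdivrMr // [e * _]mulrC.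
have b2 := kboundZ (k%:R^-1 : C) (kboundD bD bG).
have le : normc (k%:R^-1 : C) * (k%:R * rho + Num.sqrt (13%:R * (3%:R * rho) ^+ 2 * k%:R)) <= rho + e.
  by rewrite nk [leLHS]mulrC ler_pdivrMr // [(rho + e) * _]mulrC mulrDr lerD2l; exact: sk.
apply: (kboundW le); apply: (kbound_eq _ b2) => n m _ _.
by rewrite /hk /sq_lin addr0 subrK mulrBr mulKf.
Qed.

End AveragedHooks.

(** * Coefficients of bidual elements *)

Section Bidual.
Variables (R : realType) (V : completeNormedModType R[i]) (j : sq R -> V).
Hypothesis j_lin : forall (k : R[i]) (c d : sq R), inX c -> inX d ->
  j (sq_lin k c d) = k *: j c + j d.
Hypothesis j_isom : forall c : sq R, inX c -> `|j c| = ((normX c)%:C)%C.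
Hypothesis j_dense : forall (v : V) (eps : R), 0 < eps ->
  exists2 c, inX c & `|v - j c| < (eps%:C)%C.
Local Notation normc := (@ComplexField.Normc.normc R).
Local Notation C := R[i].
Local Notation sq := (sq R).
Implicit Types (a b c d al be : sq) (Phi : bfnl R).

(** The explicit candidate for [U Phi], obtained by applying [Phi] to the coefficient
    functionals. *)
Definition bcoef Phi : sq := fun n => if n == 0%N then 0 else Phi (fun be => be n).

Lemma pair_delta al n : (0 < n)%N -> pair al (delta R n) = al n.
Proof.
move=> n0; have sn : supp_in (delta R n) n.+1.
  by split=> [|m hm]; rewrite /delta; [rewrite ltn_eqF|rewrite gtn_eqF].
rewrite (pairE _ sn) (bigD1_seq n) ?mem_index_iota ?n0 ?ltnSn //; last exact: iota_uniq.
rewrite /delta eqxx mulr1 big1 ?[LHS]addr0 // => m /negbTE ->.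
by rewrite mulr0.
Qed.

Lemma pair_bcoef Phi c : in_bidual Phi -> inX c -> pair (bcoef Phi) c = Phi (fun be => pair be c).
Proof.
move=> hPhi hc.
have lin (k : C) (x y : sq) : fsupp x -> fsupp y ->
    Phi (fun be => pair be (sq_lin k x y)) =
    k *: (Phi (fun be => pair be x) : C^o) + Phi (fun be => pair be y).
  move=> hx hy; have -> : (fun be => pair be (sq_lin k x y)) = (fun be => k * pair be x + pair be y).
    by apply/funext => be; rewrite pair_linr.
  by rewrite (proj1 hPhi) //; apply: in_dual_pair; exact/inXP.
have /inXP [N sN] := hc.
rewrite [RHS](fsupp_linear_sum (f := fun x => Phi (fun be => pair be x)) lin sN) (pairE _ sN).
apply: eq_big_nat => n /andP[n0 _]; rewrite /bcoef gtn_eqF // mulrC; congr (_ * Phi _).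
by apply/funext => be; rewrite pair_delta.
Qed.

Lemma normX_dconv a b : fsupp a -> fsupp b -> normX (dconv a b) <= l2norm a * l2norm b.
Proof.
move=> fa fb; have := @normX_le_rep R (dconv a b) [:: (a, b)]; rewrite big_seq1 /=; apply.
split; first by move=> p; rewrite inE => /eqP ->.
by apply/funext => n; rewrite /conv_sum big_seq1.
Qed.

Lemma dualnorm_pair c : inX c -> dualnorm (fun be => pair be c) <= normX c.
Proof.
move=> hc; apply: dualnorm_le; split; first exact: normX_ge0.
by move=> al [ha _]; rewrite mulrC; apply: normc_pair_le => //; exact: opnorm_bound.
Qed.

Lemma inM_bcoef Phi : in_bidual Phi -> inM (bcoef Phi).
Proof.
move=> hPhi; split=> //; exists (bidualnorm Phi); split; first exact: bidualnorm_ge0.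
move=> a b N sa sb; rewrite -(pair_dconv _ sa sb).
have fa : fsupp a by exists N.
have fb : fsupp b by exists N.
have hX : inX (dconv a b) by apply/inXP; exact: fsupp_dconv.
rewrite pair_bcoef // (le_trans (le_bidualnorm hPhi (in_dual_pair hX))) //.
rewrite -mulrA ler_wpM2l ?bidualnorm_ge0 // (le_trans (dualnorm_pair hX)) //.
exact: normX_dconv.
Qed.

Lemma bidual_Lext_near Phi v c : in_bidual Phi -> inX c ->
  normc (Phi (Lext j v) - pair (bcoef Phi) c) <= bidualnorm Phi * nv (v - j c).
Proof.
move=> hPhi hc; rewrite pair_bcoef //.
have dv := Lext_in_dual j_lin j_isom j_dense v; have dc := in_dual_pair hc.
have dd := Lext_in_dual j_lin j_isom j_dense (-1 *: j c + v).
have -> : Phi (Lext j v) - Phi (fun be => pair be c) = Phi (Lext j (-1 *: j c + v)).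
  transitivity (Phi (fun al => -1 * pair al c + Lext j v al)).
    by rewrite (proj1 hPhi) // mulN1r addrC.
  apply: bidual_ext => //; first exact: in_dual_lin.
  move=> al [ha _]; rewrite Lext_lin // (Lext_j j_lin j_isom) //.
apply: (le_trans (le_bidualnorm hPhi dd)); rewrite Lext_dualnorm //.
by rewrite scaleN1r addrC.
Qed.

(** By surjectivity every functional on M_0 comes from the completion of X, and near elements of X
    [Phi] is the pairing with its coefficients. *)
Lemma bidualnorm_le_opnorm Phi : in_bidual Phi -> bidualnorm Phi <= opnorm (bcoef Phi).
Proof.
move=> hPhi; have ha := inM_bcoef hPhi; apply: bidualnorm_le; split; first exact: opnorm_ge0.
move=> phi hphi; have [v hv] := Lext_onto j_lin j_isom hphi.
have dv := Lext_in_dual j_lin j_isom j_dense v.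
rewrite (bidual_ext hPhi hphi dv); last by move=> al hal; rewrite hv.
have -> : dualnorm phi = nv v.
  rewrite -(Lext_dualnorm j_lin j_isom j_dense v); apply/le_anti/andP; split; apply: dualnorm_le.
    split=> [|al hal]; first exact: dualnorm_ge0.
    by rewrite -hv //; exact: le_dualnorm.
  split=> [|al hal]; first exact: dualnorm_ge0.
  by rewrite hv //; exact: le_dualnorm.
apply/ler_addgt0Pl => e e0.
have K0 := opnorm_ge0 (bcoef Phi); set K := opnorm (bcoef Phi) in K0 *.
have B0 := bidualnorm_ge0 Phi; set B := bidualnorm Phi in B0.
have D0 : 0 < K + B + 1 by lra.
have [c hc h1] := j_near j_dense v (divr_gt0 e0 D0).
have h2 := bidual_Lext_near v hPhi hc; have h3 := normc_pair_le (opnorm_bound ha) hc.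
rewrite -/K -(nv_j j_isom hc) in h3; rewrite -/B in h2.
have h4 := ler_normcD (Phi (Lext j v) - pair (bcoef Phi) c) (pair (bcoef Phi) c).
rewrite subrK in h4.
have h5 : nv (j c) <= nv v + nv (v - j c).
  by have := nv_distD v (j c) 0; rewrite !subr0 (nv_distC (j c)) addrC.
have h6 := ler_wpM2l K0 h5; have h7 := ler_wpM2l K0 (ltW h1); have h8 := ler_wpM2l B0 (ltW h1).
have h9 : (K + B) * (e / (K + B + 1)) <= e.
  by rewrite mulrA ler_pdivrMr // mulrC ler_pM2l //; lra.
by lra.
Qed.

(* Uniqueness of U: an isometry fixing M_0 cannot change the distances to elements of M_0,
   and these distances determine each coefficient. *)
Lemma isometry_bcoef (U : bfnl R -> sq) Phi :
  (forall (k : C) Phi Psi, in_bidual Phi -> in_bidual Psi ->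
     U (fun phi => k * Phi phi + Psi phi) = sq_lin k (U Phi) (U Psi)) ->
  (forall Phi, in_bidual Phi -> inM (U Phi)) ->
  (forall Phi, in_bidual Phi -> opnorm (U Phi) = bidualnorm Phi) ->
  (forall al, inM0 al -> U (iotaM al) = al) ->
  in_bidual Phi -> U Phi = bcoef Phi.
Proof.
move=> Ulin UM Uisom Uid hPhi; apply/funext => n.
case: n => [|n]; first by rewrite (proj1 (UM _ hPhi)).
set be := U Phi; set al := bcoef Phi; have ha : inM al := inM_bcoef hPhi.
apply/eqP; rewrite -subr_eq0; apply/eqP.
apply: (@normc_le_eps _ 2) => // e e0.
have [u nu eu] := rotation_exists (be n.+1 - al n.+1); set D := normc _ in eu *.
pose rho := opnorm al + 1.
have rho0 : 0 < rho by rewrite ltr_wpDl ?opnorm_ge0.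
have brho : kbound (hk al) rho by apply: kboundW (opnorm_bound ha); rewrite lerDl.
have nz : normc (conjc u) = 1 by rewrite normcJ.
have [z [fz zn bz]] := averaged_truncation brho (erefl _ : al 0%N = 0) rho0 (ltn0Sn n) nz e0.
pose x : sq := sq_lin ((rho%:C)%C * conjc u) (delta R n.+1) (fun=> 0).
have fx : fsupp x by apply: fsupp_lin; [exact: fsupp_delta|exact: fsupp0].
pose ga := sq_lin (-1) z x.
have fga : fsupp ga by exact: fsupp_lin.
have hga := inM0_fsupp fga; have iga := in_bidual_iota hga.
pose Psi : bfnl R := fun phi => 1 * iotaM ga phi + Phi phi.
have hPsi : in_bidual Psi by exact: in_bidual_lin.
have cPsi : bcoef Psi = sq_lin 1 ga al.
  apply/funext => -[|m]; last by rewrite /sq_lin /al /bcoef.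
  by rewrite /sq_lin (fsupp_at0 fga) mulr0 add0r.
have uPsi : U Psi = sq_lin 1 ga be by rewrite /Psi Ulin // Uid.
have le1 : opnorm (sq_lin 1 ga be) <= rho + e.
  rewrite -uPsi Uisom // (le_trans (bidualnorm_le_opnorm hPsi)) // cPsi; apply: opnorm_le.
  apply: (kbound_eq _ bz) => k m _ _; rewrite /hk /ga /x /sq_lin; ring.
have hM : inM (sq_lin 1 ga be) by rewrite -uPsi; exact: UM.
have := le_trans (normc_le_opnorm n.+1 hM) le1.
(* Entry [n.+1] has modulus at least rho + D - e, while the norm is at most rho + e; hence D <= 2
   e. *)
have e1 : u * sq_lin 1 ga be n.+1 = ((rho + D)%:C)%C - u * (z n.+1 - al n.+1).
  rewrite rmorphD /= -eu /sq_lin /ga /x /sq_lin /delta eqxx mulr1 addr0.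
  have uu : u * conjc u = 1 by rewrite mulcJ_normc nu expr1n rmorph1.
  transitivity (u * conjc u * (rho%:C)%C + u * (be n.+1 - z n.+1)); first by ring.
  by rewrite uu; ring.
have e2 : normc (u * sq_lin 1 ga be n.+1) = normc (sq_lin 1 ga be n.+1) by rewrite normcM nu mul1r.
rewrite -e2 e1 => h1.
have h2 := ler_normcD (((rho + D)%:C)%C - u * (z n.+1 - al n.+1)) (u * (z n.+1 - al n.+1)).
rewrite subrK normc_real [normc (u * _)]normcM nu mul1r in h2.
have D0 : 0 <= D := normc_ge0 _.
rewrite ger0_norm in h2; last by lra.
by lra.
Qed.

End Bidual.

(** * The extension of L and the adjoint identity *)

Theorem theorem3 (R : realType) (V : completeNormedModType R[i])
  (j : sq R -> V)
  (* (V, j) is a Banach space completion of (X, ||.||_X) *)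
  (j_lin : forall (k : R[i]) (c d : sq R), inX c -> inX d ->
     j (sq_lin k c d) = k *: j c + j d)
  (j_isom : forall c : sq R, inX c -> `|j c| = ((normX c)%:C)%C)
  (j_dense : forall (v : V) (eps : R), 0 < eps ->
     exists2 c, inX c & `|v - j c| < (eps%:C)%C) :
  exists Lt : V -> fnl R,
    (* Lt v lies in M_0^* *)
    (forall v, in_dual (Lt v))
    (* Lt is linear *)
    /\ (forall (k : R[i]) (u v : V) (alpha : sq R), inM0 alpha ->
          Lt (k *: u + v) alpha = k * Lt u alpha + Lt v alpha)
    (* Lt extends L : (Lc)(M(alpha)) = (alpha, c) *)
    /\ (forall c, inX c -> forall alpha, inM0 alpha -> Lt (j c) alpha = pair alpha c)
    (* Lt is isometric *)
    /\ (forall v, ((dualnorm (Lt v))%:C)%C = `|v|)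
    (* Lt is onto M_0^* *)
    /\ (forall phi, in_dual phi ->
          exists v, forall alpha, inM0 alpha -> Lt v alpha = phi alpha)
    (* L^* U^{-1} = J *)
    /\ (forall (U : bfnl R -> sq R) (J : sq R -> V -> R[i]),
          (* U : M_0^** -> M isometric isomorphism with U iota m = m *)
          (forall Phi, in_bidual Phi -> inM (U Phi)) ->
          (forall (k : R[i]) Phi Psi, in_bidual Phi -> in_bidual Psi ->
             U (fun phi => k * Phi phi + Psi phi) = sq_lin k (U Phi) (U Psi)) ->
          (forall Phi, in_bidual Phi -> opnorm (U Phi) = bidualnorm Phi) ->
          (forall alpha, inM alpha -> exists2 Phi, in_bidual Phi & U Phi = alpha) ->
          (forall alpha, inM0 alpha -> U (iotaM alpha) = alpha) ->
          (* J m in X^* is the bounded linear functional with Jm(c) = (alpha, c) *)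
          (forall alpha, inM alpha -> forall (k : R[i]) (u v : V),
             J alpha (k *: u + v) = k * J alpha u + J alpha v) ->
          (forall alpha, inM alpha -> exists K : R, forall v : V,
             `|J alpha v| <= (K%:C)%C * `|v|) ->
          (forall alpha, inM alpha -> forall c, inX c -> J alpha (j c) = pair alpha c) ->
          forall Phi, in_bidual Phi -> forall v : V, Phi (Lt v) = J (U Phi) v).
Proof.
exists (Lext j); split; first exact: Lext_in_dual.
split; first by move=> k u v al [ha _]; exact: Lext_lin.
split; first by move=> c hc al [ha _]; exact: Lext_j.
split; first by move=> v; rewrite Lext_dualnorm // nvE.
split; first by move=> phi; exact: Lext_onto.
move=> U J UM Ulin Uisom _ Uid Jlin Jbnd Jpair Phi hPhi v.
have hU := UM _ hPhi; have eU := isometry_bcoef j_lin j_isom j_dense Ulin UM Uisom Uid hPhi.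
have [K hK] := Jbnd _ hU; apply/eqP; rewrite -subr_eq0; apply/eqP.
have B0 := bidualnorm_ge0 Phi.
(* Both sides are bounded in [v] and agree on X, where each is the pairing with the coefficients of
   [Phi]; density gives equality. *)
apply: (@normc_le_eps _ (bidualnorm Phi + `|K|)); first by rewrite addr_ge0.
move=> e e0; have [c hc h1] := j_near j_dense v e0.
have h2 := bidual_Lext_near j_lin j_isom j_dense v hPhi hc; rewrite -eU in h2.
have eJ : J (U Phi) v - pair (U Phi) c = J (U Phi) (v - j c).
  have -> : v - j c = -1 *: j c + v by rewrite scaleN1r addrC.
  by rewrite -(Jpair _ hU _ hc) Jlin // mulN1r addrC.
have h3 : ComplexField.Normc.normc (J (U Phi) (v - j c)) <= K * nv (v - j c).
  by have := hK (v - j c); rewrite normc_norm nvE -rmorphM lecR.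
apply: (le_trans (ler_normc_distD (pair (U Phi) c) _ _)).
rewrite [X in _ + X]normc_distC eJ mulrDl lerD //.
  by apply: (le_trans h2); rewrite ler_wpM2l // ltW.
apply: (le_trans h3); apply: (@le_trans _ _ (`|K| * nv (v - j c))).
  by rewrite ler_wpM2r ?nv_ge0 // ler_norm.
by rewrite ler_wpM2l // ltW.
Qed.
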